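(* Let $m\ge2$ and for $\vec t=(t_1,\dots,t_m)\in\mathbb R^m$ write $V_{\vec t}(x)=\frac{x^2}2+\sum_{j=1}^m t_jx^j$. Suppose $V_{\vec t}\in P_m^{(1)}$. Then there exists a continuous path $\tau\mapsto\vec t(\tau)$, $[0,1]\to\mathbb R^m$, with $\vec t(0)=0$ (so $V_{\vec t(0)}(x)=x^2/2$), $\vec t(1)=\vec t$, and $V_{\vec t(\tau)}\in P_m^{(1)}$ for all $\tau\in[0,1]$.
   Context: $P_m$ is the set of real polynomials of even degree $\le m$ with positive leading coefficient and $V(0)=0$. For $V\in P_m$, $\mu_V$ is the unique Borel probability measure on $\mathbb R$ minimizing $\iint\log|x-y|^{-1}d\mu(x)d\mu(y)+\int Vd\mu$; it satisfies $2\int\log|x-y|d\mu_V(y)-V(x)=\ell_V$ on $\operatorname{supp}\mu_V$ and $\le \ell_V$ on $\mathbb R$ for a constant $\ell_V$. $V$ is $k$-cut regular if $\operatorname{supp}\mu_V$ is a union of exactly $k$ disjoint compact intervals $\cup_j[\alpha_j,\beta_j]$, the density of $\mu_V$ equals $\frac1c\sqrt{|\prod_j(x-\alpha_j)(x-\beta_j)|}\,|h(x)|$ with $h$ a polynomial without zeros on $\operatorname{supp}\mu_V$, and the inequality is strict on $\mathbb R\setminus\operatorname{supp}\mu_V$. $P_m^{(k)}\subset P_m$ denotes the $k$-cut regular elements. *)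

(* Defs.v *)
From HB Require Import structures.
From mathcomp Require Import all_boot all_order all_algebra.
From mathcomp Require Import all_classical all_reals all_analysis.
Set Implicit Arguments. Unset Strict Implicit. Unset Printing Implicit Defensive.
Import Order.TTheory GRing.Theory Num.Theory.
Import numFieldNormedType.Exports.
Local Open Scope classical_set_scope.
Local Open Scope ring_scope.

Section Defs.
Variable R : realType.

Definition in_Pm (m : nat) (V : {poly R}) : Prop :=
  [/\ ~~ odd (size V).-1, (size V <= m.+1)%N, 0 < lead_coef V & V.[0] = 0].

Definition energy_kernel (V : {poly R}) (x y : R) : \bar R :=
  if x == y then +oo%E else (- ln `|x - y| + (V.[x] + V.[y]) / 2)%:E.

(* I_V(mu) = iint log|x-y|^{-1} dmu dmu + int V dmu, written with the
   symmetrized (bounded below) integrand *)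
Definition energy (V : {poly R}) (mu : probability R R) : \bar R :=
  (\int[mu]_x \int[mu]_y energy_kernel V x y)%E.

Definition is_equilibrium_measure (V : {poly R}) (mu : probability R R) : Prop :=
  forall nu : probability R R, (energy V mu <= energy V nu)%E.

Definition oitv (x e : R) : set R := [set y | x - e < y < x + e].

Definition msupp (mu : probability R R) : set R :=
  [set x | forall e : R, 0 < e -> (0 < mu (oitv x e))%E].

Definition log_potential (mu : probability R R) (x : R) : \bar R :=
  (\int[mu]_y (if y == x then -oo else (ln `|x - y|)%:E))%E.

(* 1-cut regularity of V, for mu = mu_V the (unique) equilibrium measure *)
Definition one_cut_regular (V : {poly R}) : Prop :=
  exists mu : probability R R,
    is_equilibrium_measure V mu /\
    exists (a b c : R) (h : {poly R}),
      [/\ a < b /\ msupp mu = `[a, b]%classic, 0 < c,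
          (forall x, a <= x <= b -> h.[x] != 0),
          (forall A, measurable A ->
             mu A = (\int[lebesgue_measure]_(x in A)
                ((if a <= x <= b then
                   c^-1 * Num.sqrt `|(x - a) * (x - b)| * `|h.[x]|
                  else 0)%:E))%E) &
          (exists l : R,
            (forall x, a <= x <= b ->
               (2%:E * log_potential mu x - (V.[x])%:E = l%:E)%E) /\
            (forall x, ~ (a <= x <= b) ->
               (2%:E * log_potential mu x - (V.[x])%:E < l%:E)%E))].

Definition in_Pm1 (m : nat) (V : {poly R}) : Prop :=
  in_Pm m V /\ one_cut_regular V.

(* V_t(x) = x^2/2 + sum_{j=1}^m t_j x^j ; t_j is stored at index j-1 *)
Definition Vt (m : nat) (t : 'rV[R]_m) : {poly R} :=
  (2^-1)%:P * 'X^2 + \sum_(i < m) t ord0 i *: 'X^(i.+1).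

End Defs.

(* Main.v *)
(* After an affine change of variable the support of the equilibrium measure of
   V is [-1, 1], where the equilibrium measure of 2 x^2 is the semicircle law.
   For a fixed support the Euler-Lagrange conditions are linear in the pair
   (density, field), so a convex combination of two one-cut regular fields with
   the same support is again one-cut regular.  The path is
   ((1 - s) 2 x^2 + s V o A) o B_s minus its value at 0, where A maps [-1, 1] onto
   the support of V and the affine map B_s interpolates between x / 2 (s = 0)
   and A^-1 (s = 1).

   The Euler-Lagrange conditions imply minimality because the logarithmic
   kernel is conditionally positive definite: truncated at scale L, it is the
   integral of r^-2 (indicator of [z, z + r])(x) (indicator of [z, z + r])(y)
   over z and 0 < r <= L.  The potential of the semicircle law is computed with
   y = cos t, from ln |cos p - cos t| = ln |2 sin ((p - t) / 2)| +
   ln |2 sin ((p + t) / 2)| - ln 2 and the first Fourier coefficients of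
   ln |2 sin (t / 2)|. *)
Require Import Defs.
From HB Require Import structures.
From mathcomp Require Import all_boot all_order all_algebra.
From mathcomp Require Import all_classical all_reals all_analysis.
From mathcomp Require Import measurable_realfun ring lra.
Set Implicit Arguments.
Unset Strict Implicit.
Unset Printing Implicit Defensive.
Import Order.TTheory GRing.Theory Num.Theory.
Import numFieldNormedType.Exports.
Local Open Scope classical_set_scope.
Local Open Scope ring_scope.

(** The Euler-Lagrange conditions interpolate linearly, minimality does not: it has to be re-proved
    for every field on the path, and [one_cut_data] records the linear conditions alone. So that all
    energies are integrals of nonnegative functions, the kernel is shifted by |x| + |y| and the
    field pays for the shift. Hence the bound 4 |x| - C <= V carried along, which also disposes of
    competitors with infinite first moment. Truncation at scale L changes the kernel by the constant
    ln L - 1, which cancels, and by an error of at most (|x| + |y|) / L, so finite first moments let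
    L grow. For the semicircle law two quantities are never evaluated. The mean of ln |2 sin (t /
    2)| over a period is absorbed in the Euler-Lagrange constant. Off [-1, 1] the tangent bound for
    ln replaces a closed form: the mean of 1 / |1 - y| is at most 2, the slope of x^2 at the edge,
    and the field wins by 2 (|x| - 1)^2. *)

Local Notation pushforward_measure :=
  measure_function_pushforward__canonical__measure_function_Measure.

(** * Affine changes of variable *)

Section affine.
Context {R : realType}.
Local Notation leb := (@lebesgue_measure R).

Lemma measurable_affine (r u : R) :
  measurable_fun (setT : set (measurableTypeR R))
    (fun y => r * y + u : measurableTypeR R).
Proof. by apply: measurable_funD => //; exact: measurable_funM. Qed.

(** The rescaled image measure gives half-open intervals their length, which characterizes Lebesgue
    measure. For r < 0 the preimage is half-open on the other side, with the same length. *)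
Lemma lebesgue_measure_affine (r u : R) (A : set R) : r != 0 -> measurable A ->
  (`|r|%:E * leb ((fun y => r * y + u)%R @^-1` A) = leb A)%E.
Proof.
move=> r0 mA.
have r0' : 0 < `|r| by rewrite normr_gt0.
pose mf := measurable_affine r u.
pose pm := pushforward_measure leb mf.
transitivity (mscale (NngNum (ltW r0')) pm A); first by rewrite /mscale /pushforward.
pose m : {measure set (measurableTypeR R) -> \bar R} := mscale (NngNum (ltW r0')) pm.
apply/esym; apply: (@lebesgue_measure_unique R m) => //= _ [[a b]] _ <-.
rewrite /m /mscale /= /pushforward.
have [rp|rn] : (0 < r) \/ (r < 0) by case: (ltgtP r 0) r0 => //; auto.
  have -> : (fun y => r * y + u) @^-1` `]a, b] = `](a - u) / r, (b - u) / r]%classic.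
    apply/seteqP; split=> y /=; rewrite !in_itv /= ltr_pdivrMr// ler_pdivlMr// (mulrC y).
      by move=> /andP[? ?]; apply/andP; split; lra.
    by move=> /andP[? ?]; apply/andP; split; lra.
  rewrite !lebesgue_measure_itv /= !lte_fin ltr_pM2r ?invr_gt0// ltrD2r.
  case: ifP => _; last by rewrite mule0.
  rewrite -!EFinB -EFinM gtr0_norm//; congr EFin; field.
  by rewrite gt_eqF.
have -> : (fun y => r * y + u) @^-1` `]a, b] = `[(b - u) / r, (a - u) / r[%classic.
  apply/seteqP; split=> y /=; rewrite !in_itv /= ltr_ndivlMr// ler_ndivrMr// (mulrC y).
    by move=> /andP[? ?]; apply/andP; split; lra.
  by move=> /andP[? ?]; apply/andP; split; lra.
rewrite !lebesgue_measure_itv /= !lte_fin ltr_nM2r ?invr_lt0// ltrD2r.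
case: ifP => _; last by rewrite mule0.
rewrite -!EFinB -EFinM ltr0_norm//; congr EFin; field.
by rewrite lt_eqF.
Qed.

Lemma ge0_integral_affine (r u : R) (f : R -> \bar R) : r != 0 ->
  measurable_fun setT f -> (forall y, (0 <= f y)%E) ->
  (\int[leb]_y f y = `|r|%:E * \int[leb]_y f (r * y + u)%R)%E.
Proof.
move=> r0 mf f0.
have r0' : 0 < `|r| by rewrite normr_gt0.
have ma := measurable_affine r u.
pose pm := pushforward_measure leb ma.
transitivity (\int[mscale (NngNum (ltW r0')) pm]_y f y)%E.
  apply: eq_measure_integral => A mA _.
  exact/esym/lebesgue_measure_affine.
rewrite ge0_integral_mscale//=.
by rewrite ge0_integral_pushforward.
Qed.

Lemma integrable_affine (r u : R) (f : R -> \bar R) : r != 0 ->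
  leb.-integrable setT f -> leb.-integrable setT (fun y => f (r * y + u)).
Proof.
move=> r0 /integrableP[mf fi]; apply/integrableP; split.
  exact: (measurableT_comp mf (measurable_affine r u)).
move: fi; rewrite (ge0_integral_affine u r0)//; last exact: measurableT_comp.
have : (0 <= \int[leb]_y `|f (r * y + u)%R|)%E by exact: integral_ge0.
case: (\int[leb]_y `|f (r * y + u)%R|)%E => [? _ _|_|//]; first exact: ltry.
by rewrite gt0_muley ?lte_fin ?normr_gt0.
Qed.

Lemma integral_affine (r u : R) (f : R -> \bar R) : r != 0 ->
  leb.-integrable setT f ->
  (\int[leb]_y f y = `|r|%:E * \int[leb]_y f (r * y + u)%R)%E.
Proof.
move=> r0 fi; pose g y := f (r * y + u).
have gi : leb.-integrable setT g := integrable_affine u r0 fi.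
have mf := measurable_int _ fi.
have pE : (\int[leb]_y f^\+ y = `|r|%:E * \int[leb]_y g^\+ y)%E.
  rewrite (ge0_integral_affine u r0 (f := f^\+%E))//; last exact: measurable_funepos.
  by congr (_ * _)%E; apply: eq_integral => y _; rewrite !funeposE.
have nE : (\int[leb]_y f^\- y = `|r|%:E * \int[leb]_y g^\- y)%E.
  rewrite (ge0_integral_affine u r0 (f := f^\-%E))//; last exact: measurable_funeneg.
  by congr (_ * _)%E; apply: eq_integral => y _; rewrite !funenegE.
rewrite -[(\int[leb]_y f (r * y + u)%R)%E]/(\int[leb]_y g y)%E.
rewrite integralE [in RHS]integralE pE nE.
have := integrable_pos_fin_num measurableT gi.
have := integrable_neg_fin_num measurableT gi.
case: (\int[leb]_y g^\- y)%E => [b||] // _; case: (\int[leb]_y g^\+ y)%E => [a||] // _.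
exact: (congr1 EFin (esym (mulrBr _ _ _))).
Qed.

End affine.

(** * Positive definite kernels *)

Section integral_minus.
Context d (T : measurableType d) (R : realType).
Variable P : probability T R.

Lemma integral_cst_prob (c : \bar R) : (\int[P]_x c = c)%E.
Proof.
rewrite (integral_cst P measurableT c) -[RHS]mule1; congr (_ * _)%E.
exact: probability_setT.
Qed.

(** Energies may be +oo, so f need not be integrable. If its integral is infinite, so is that of the
    positive part of f - c, while the negative part is bounded by c. *)
Lemma ge0_integralB_cst (f : T -> \bar R) (c : R) :
  measurable_fun setT f -> (forall x, 0 <= f x)%E -> 0 <= c ->
  (\int[P]_x (f x - c%:E) = \int[P]_x f x - c%:E)%E.
Proof.
move=> mf f0 c0.
have cE : (\int[P]_x c%:E = c%:E)%E by exact: integral_cst_prob.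
have ci : P.-integrable setT (cst c%:E).
  exact: finite_measure_integrable_cst.
have [fi|] := boolP (\int[P]_x f x < +oo)%E.
  have fint : P.-integrable setT f.
    by apply/integrableP; split=> //; under eq_integral do rewrite gee0_abs//.
  by have /= -> := integralB measurableT fint ci; rewrite cE.
rewrite -leNgt leye_eq => /eqP fy.
have mg : measurable_fun setT (fun x => f x - c%:E)%E by exact: emeasurable_funB.
have neg : (\int[P]_x (fun x => f x - c%:E)^\- x <= c%:E)%E.
  rewrite -[leRHS]cE; apply: ge0_le_integral; [by []|by []| |exact: measurable_cst|].
    exact: (measurable_funeneg mg).
  move=> x _; rewrite funenegE ge_max lee_fin c0 andbT.
  have := f0 x; case: (f x) => [a a0|_|//]; last by rewrite addye//= leNye.
  by rewrite -EFinB -EFinN lee_fin opprB gerBl -lee_fin.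
have pos : (\int[P]_x (fun x => f x - c%:E)^\+ x = +oo)%E.
  apply/eqP; rewrite -leye_eq -fy.
  have h : (\int[P]_x f x <= \int[P]_x ((fun x => f x - c%:E)^\+ x + c%:E))%E.
    apply: ge0_le_integral => //.
      by apply: emeasurable_funD => //; exact: measurable_funepos.
    move=> x _; rewrite -leeBlDr// funeposE.
    by rewrite le_max lexx.
  move: h; rewrite ge0_integralD//; last exact: measurable_funepos.
  rewrite cE fy !leye_eq.
  by case: (\int[P]_x (fun x => f x - c%:E)^\+ x)%E.
rewrite fy integralE pos.
have n0 : (0 <= \int[P]_x (fun x => f x - c%:E)^\- x)%E by exact: integral_ge0.
by case: (\int[P]_x _)%E neg n0.
Qed.

End integral_minus.

(** * Iterated integrals of nonnegative kernels *)

Section double_integral.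
Context d (T : measurableType d) (R : realType).
Implicit Types (P Q : probability T R) (f g : T -> T -> \bar R).
Local Open Scope ereal_scope.

Definition iint P Q f := \int[P]_x \int[Q]_y f x y.
Arguments iint : simpl never.

Definition mfun2 f := measurable_fun setT (fun z : T * T => f z.1 z.2).

Lemma mfun2_section f x : mfun2 f -> measurable_fun setT (f x).
Proof.
move=> mf.
have -> : f x = (fun z : T * T => f z.1 z.2) \o pair x by [].
by apply: measurableT_comp => //; exact: measurable_pair1.
Qed.

Lemma mfun2_integral Q f : mfun2 f -> (forall x y, 0 <= f x y) ->
  measurable_fun setT (fun x => \int[Q]_y f x y).
Proof.
move=> mf f0.
exact: (@measurable_fun_fubini_tonelli_F _ _ _ _ _ Q (fun z : T * T => f z.1 z.2)).
Qed.

Lemma iint_ge0 P Q f : (forall x y, 0 <= f x y) -> 0 <= iint P Q f.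
Proof. by move=> f0; apply: integral_ge0 => x _; exact: integral_ge0. Qed.

Lemma iintD P Q f g : mfun2 f -> mfun2 g ->
  (forall x y, 0 <= f x y) -> (forall x y, 0 <= g x y) ->
  iint P Q (fun x y => f x y + g x y) = iint P Q f + iint P Q g.
Proof.
move=> mf mg f0 g0; rewrite /iint.
under eq_integral => x _.
  rewrite ge0_integralD//; [over|exact: mfun2_section|exact: mfun2_section].
rewrite ge0_integralD//.
- by move=> x _; exact: integral_ge0.
- exact: mfun2_integral.
- by move=> x _; exact: integral_ge0.
- exact: mfun2_integral.
Qed.

Lemma le_iint P Q f g : mfun2 f -> mfun2 g ->
  (forall x y, 0 <= f x y) -> (forall x y, f x y <= g x y) ->
  iint P Q f <= iint P Q g.
Proof.
move=> mf mg f0 fg.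
have g0 x y : 0 <= g x y by exact: le_trans (fg x y).
apply: ge0_le_integral => //.
- by move=> x _; exact: integral_ge0.
- exact: mfun2_integral.
- exact: mfun2_integral.
move=> x _; apply: ge0_le_integral => //; exact: mfun2_section.
Qed.

Lemma iint_fst P Q (f : T -> \bar R) :
  iint P Q (fun x _ => f x) = \int[P]_x f x.
Proof.
apply: eq_integral => x _.
exact: integral_cst_prob.
Qed.

Lemma iint_snd P Q (f : T -> \bar R) :
  iint P Q (fun _ y => f y) = \int[Q]_x f x.
Proof. exact: integral_cst_prob. Qed.

End double_integral.

(** The L^2(rho) inner product of the feature functions phi (x, .) and phi (y, .): a positive
    definite kernel by construction. *)
Definition gram d d' (T : measurableType d) (S : measurableType d') (R : realType)
    (rho : {sigma_finite_measure set S -> \bar R}) (phi : T * S -> R) (x y : T) :=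
  (\int[rho]_p (phi (x, p) * phi (y, p))%:E)%E.

Section positive_definite.
Context d d' (T : measurableType d) (S : measurableType d') (R : realType).
Variable rho : {sigma_finite_measure set S -> \bar R}.
Variable phi : T * S -> R.
Hypothesis mphi : measurable_fun setT phi.
Hypothesis phi0 : forall z, 0 <= phi z.
Local Open Scope ereal_scope.

Local Notation K := (gram rho phi).

Let mE : measurable_fun setT (EFin \o phi).
Proof. exact/measurable_EFinP. Qed.

Lemma mfun2_gram : mfun2 K.
Proof.
apply: (@measurable_fun_fubini_tonelli_F _ _ _ _ _ rho
  (fun z : (T * T) * S => (phi (z.1.1, z.2) * phi (z.1.2, z.2))%:E)).
  apply/measurable_EFinP/measurable_funM.
    by apply: measurableT_comp => //; apply: measurable_fun_pair => //;
       apply: measurableT_comp.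
  by apply: measurableT_comp => //; apply: measurable_fun_pair => //;
     apply: measurableT_comp.
by move=> z; rewrite lee_fin mulr_ge0.
Qed.

Lemma gram_ge0 x y : 0 <= K x y.
Proof. by apply: integral_ge0 => p _; rewrite lee_fin mulr_ge0. Qed.

Let Phi (P : probability T R) p := \int[P]_x (phi (x, p))%:E.

Let mPhi P : measurable_fun setT (Phi P).
Proof. exact: (measurable_fun_fubini_tonelli_G (EFin \o phi)). Qed.

Let Phi0 P p : 0 <= Phi P p.
Proof. by apply: integral_ge0 => x _; rewrite lee_fin. Qed.

(** Two uses of Tonelli move the integral over [rho] outside, leaving the inner product of the
    averaged features of P and Q. *)
Lemma iint_gram P Q : iint P Q K = \int[rho]_p (Phi P p * Phi Q p).
Proof.
have mfst : measurable_fun setT (fun p : T * S => (phi p)%:E) by [].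
transitivity (\int[P]_x \int[rho]_p ((phi (x, p))%:E * Phi Q p)).
  apply: eq_integral => x _.
  rewrite /gram (fubini_tonelli (m1 := Q) (m2 := rho)
    (fun z : T * S => (phi (x, z.2) * phi z)%:E)) /=; last 2 first.
  - apply/measurable_EFinP/measurable_funM => //.
    by apply: measurableT_comp => //; apply: measurable_fun_pair.
  - by move=> z; rewrite lee_fin mulr_ge0.
  apply: eq_integral => p _.
  under eq_integral do rewrite EFinM.
  rewrite ge0_integralZl//.
  - apply/measurable_EFinP; apply: measurableT_comp => //; exact: measurable_pair2.
  - by move=> y _; rewrite lee_fin.
  - by rewrite lee_fin.
rewrite (fubini_tonelli (m1 := P) (m2 := rho)
    (fun z : T * S => (phi z)%:E * Phi Q z.2)) /=; last 2 first.
- apply: emeasurable_funM => //.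
  by apply: measurableT_comp.
- by move=> z; rewrite mule_ge0 ?lee_fin.
apply: eq_integral => p _; rewrite ge0_integralZr//.
- apply/measurable_EFinP; apply: measurableT_comp => //; exact: measurable_pair2.
- by move=> y _; rewrite lee_fin.
Qed.

(** Pointwise 2 a b <= a^2 + b^2 for the averaged features. No term is moved across the inequality,
    since each may be +oo. *)
Lemma gram_positive P Q :
  iint P Q K + iint P Q K <= iint P P K + iint Q Q K.
Proof.
have m2 P1 P2 : measurable_fun setT (fun p => Phi P1 p * Phi P2 p).
  exact: emeasurable_funM.
have p2 P1 P2 p : 0 <= Phi P1 p * Phi P2 p by exact: mule_ge0.
rewrite !iint_gram -!ge0_integralD//.
apply: ge0_le_integral => //.
- by move=> p _; rewrite adde_ge0.
- exact: emeasurable_funD.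
- exact: emeasurable_funD.
move=> p _; have := Phi0 P p; have := Phi0 Q p.
case: (Phi P p) => [a||]; case: (Phi Q p) => [b||] // b0 a0.
- rewrite -!EFinM -!EFinD lee_fin; have := sqr_ge0 (a - b)%R; rewrite expr2; lra.
- by rewrite mulyy addey ?leey// gt_eqF// ltNye_eq.
- by rewrite mulyy addye ?leey// gt_eqF// ltNye_eq.
Qed.

End positive_definite.

(** * The logarithmic kernel *)

Lemma integral_is_derive (R : realType) (f F : R -> R) (a b : R) : a <= b ->
  (forall x, a <= x <= b -> is_derive x 1 F (f x)) ->
  (forall x, a <= x <= b -> {for x, continuous f}) ->
  (\int[lebesgue_measure]_(x in `[a, b]) (f x)%:E = (F b - F a)%:E)%E.
Proof.
rewrite le_eqVlt => /predU1P[<- _ _|ab dF cf].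
  by rewrite set_itv1 integral_set1 subrr.
have cF x : a <= x <= b -> {for x, continuous F}.
  by move=> /dF [dFx _]; apply: differentiable_continuous; exact/derivable1_diffP.
rewrite (continuous_FTC2 (F := F) ab) ?EFinB//.
- apply: continuous_in_subspaceT => x; rewrite inE/= in_itv/=; exact: cf.
- split.
  + by move=> x; rewrite in_itv/= => /andP[ax xb]; have [] := dF x; rewrite ?ltW.
  + by apply: cvg_at_right_filter; apply: cF; rewrite lexx ltW.
  + by apply: cvg_at_left_filter; apply: cF; rewrite lexx ltW.
- move=> x; rewrite in_itv/= => /andP[ax xb]; rewrite derive1E.
  by have [] := dF x; rewrite ?ltW.
Qed.

(** The feature space of the tents: pairs (r, z) of a window length and a left end. A name of its
    own lets the sigma-finite structure required by [gram] be attached. *)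
Definition area (R : realType) := ((@lebesgue_measure R) \x (@lebesgue_measure R))%E.

HB.instance Definition _ (R : realType) := Measure.on (@area R).

Lemma area_sigma_finite (R : realType) : sigma_finite setT (@area R).
Proof.
have /sigma_finiteP[F [TF ndF Foo]] := sigma_finiteT (@lebesgue_measure R).
exists (fun n => F n `*` F n) => [|k].
  rewrite -setXTT TF predeqE => -[x y]; split.
    move=> [/= [n _ Fnx] [k _ Fky]]; exists (maxn n k) => //; split.
    - by move: x Fnx; exact/subsetPset/ndF/leq_maxl.
    - by move: y Fky; exact/subsetPset/ndF/leq_maxr.
  by move=> [n _ []/= ? ?]; split; exists n.
have [mF Fk] := Foo k.
split; first exact: measurableX.
by rewrite /area product_measure1E// lte_mul_pinfty// ge0_fin_numE.
Qed.

HB.instance Definition _ (R : realType) :=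
  @Measure_isSigmaFinite.Build _ _ _ (@area R) (@area_sigma_finite R).

Section log_kernel.
Context {R : realType}.
Implicit Types (x y L : R).
Local Notation leb := (@lebesgue_measure R).

(* The kernel [-ln |x - y|] made nonnegative by a shift that separates the
   variables and therefore cancels on differences of probability measures. *)
Definition logk (x y : R) : \bar R :=
  (if x == y then +oo else (`|x| + `|y| - ln `|x - y|)%:E)%E.

Lemma logk_ge0 x y : (0 <= logk x y)%E.
Proof.
rewrite /logk; case: eqVneq => [//|xy]; rewrite lee_fin subr_ge0.
have xy0 : 0 < `|x - y| by rewrite normr_gt0 subr_eq0.
exact: le_trans (ltW (ln_sublinear xy0)) (ler_normB _ _).
Qed.

Lemma mfun2_logk : mfun2 logk.
Proof.
rewrite /mfun2 /logk; apply: measurable_fun_ifT => //.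
  exact: measurable_fun_eqr.
apply/measurable_EFinP/measurable_funB.
  apply: measurable_funD; first exact: measurableT_comp.
  exact: measurableT_comp.
apply: measurableT_comp; first exact: measurable_ln.
by apply: measurableT_comp => //; exact: measurable_funB.
Qed.

(* [expR (- ln r)] is [r^-1], in a form that is visibly measurable. *)
Definition tent L (z : R * (measurableTypeR R * measurableTypeR R)) : R :=
  if [&& 0 < z.2.1, z.2.1 <= L, z.2.2 <= z.1 & z.1 <= z.2.2 + z.2.1]
  then expR (- ln z.2.1) else 0.

Lemma tent_ge0 L z : 0 <= tent L z.
Proof. by rewrite /tent; case: ifP => // _; exact: expR_ge0. Qed.

Lemma measurable_tent L : measurable_fun setT (tent L).
Proof.
have m21 : measurable_fun setT
    (fun z : R * (measurableTypeR R * measurableTypeR R) => z.2.1 : R).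
  exact: (measurableT_comp (@measurable_fst _ _ (measurableTypeR R) (measurableTypeR R))).
have m22 : measurable_fun setT
    (fun z : R * (measurableTypeR R * measurableTypeR R) => z.2.2 : R).
  exact: (measurableT_comp (@measurable_snd _ _ (measurableTypeR R) (measurableTypeR R))).
apply: measurable_fun_ifT => //.
- apply: measurable_and; first exact: measurable_fun_ltr.
  apply: measurable_and; first exact: measurable_fun_ler.
  apply: measurable_and; first exact: measurable_fun_ler.
  by apply: measurable_fun_ler => //; exact: measurable_funD.
- apply: measurableT_comp => //; apply: measurableT_comp => //.
  by apply: measurableT_comp => //; exact: measurable_ln.
Qed.

Definition tentk L : R -> R -> \bar R := gram (@area R) (tent L).

Lemma mfun2_tentk L : mfun2 (tentk L).
Proof. exact: mfun2_gram (measurable_tent L) (tent_ge0 L). Qed.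

Lemma tentk_ge0 L x y : (0 <= tentk L x y)%E.
Proof. exact: gram_ge0 (tent_ge0 L) _ _. Qed.

(** For x <= y, the windows [z, z + r] containing both points are those with z in [y - r, x], a set
    of length r - |x - y| or empty; each has weight r^-2. *)
Lemma integral_tent L x y (r : R) : 0 < r <= L ->
  (\int[leb]_z (tent L (x, (r, z)) * tent L (y, (r, z)))%:E =
   (Num.max 0 (r^-1 - `|x - y| * r ^- 2))%:E)%E.
Proof.
wlog xy : x y / x <= y => [H rL|/andP[r0 rL]].
  have [/H|/ltW /H] := leP x y; first exact.
  by move=> /(_ rL); rewrite distrC => <-; apply: eq_integral => z _; rewrite mulrC.
have -> : (\int[leb]_z (tent L (x, (r, z)) * tent L (y, (r, z)))%:E =
    \int[leb]_(z in `[(y - r)%R, x]) (r ^- 2)%:E)%E.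
  rewrite [RHS]integral_mkcond; apply: eq_integral => z _.
  rewrite patchE /tent /= r0 rL /= expRN lnK ?posrE//.
  have [zi|] := boolP (z \in `[y - r, x]%classic).
    move: zi; rewrite inE/= in_itv/= => /andP[h1 h2].
    rewrite (_ : _ && _ = true); last by apply/andP; split; lra.
    rewrite (_ : _ && _ = true); last by apply/andP; split; lra.
    by rewrite -expr2 exprVn.
  rewrite notin_setE/= in_itv/= => /negP/nandP h.
  case: ifP => [/andP[h1 h2]|_]; last by rewrite mul0r.
  case: ifP => [/andP[h3 h4]|_]; last by rewrite mulr0.
  by exfalso; move: h; rewrite h1 => -[]// /negP[]; lra.
rewrite integral_cst//= lebesgue_measure_itv/= lte_fin.
rewrite distrC (ger0_norm (x := y - x)) ?subr_ge0//.
have r2 : 0 < r ^- 2 by rewrite invr_gt0 exprn_gt0.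
have -> : r^-1 - (y - x) * r ^- 2 = r ^- 2 * (r - (y - x)).
  by field; rewrite gt_eqF.
case: ltP => h.
  rewrite -EFinB -EFinM max_r; first by congr EFin; ring.
  by rewrite mulr_ge0 ?ltW//; lra.
by rewrite mule0 max_l// mulr_ge0_le0 ?(ltW r2)//; lra.
Qed.

Lemma tentkE L x y : tentk L x y =
  (\int[leb]_(r in `]0%R, L]) (Num.max 0 (r^-1 - `|x - y| * r ^- 2))%:E)%E.
Proof.
rewrite /tentk /gram /area (fubini_tonelli1 (m1 := leb) (m2 := leb)
  (fun p => (tent L (x, p) * tent L (y, p))%:E)); last 2 first.
- apply/measurable_EFinP/measurable_funM; apply: measurableT_comp;
    by [exact: measurable_tent|exact: measurable_pair1].
- by move=> p; rewrite lee_fin mulr_ge0 ?tent_ge0.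
rewrite [RHS]integral_mkcond; apply: eq_integral => r _.
rewrite /fubini_F patchE; case: ifPn => [|].
  by rewrite inE/= in_itv/= => /integral_tent ->.
rewrite notin_setE/= in_itv/= => /negP rL.
under eq_integral => z _.
  rewrite /tent /= andbA (negbTE rL) /= mul0r; over.
by rewrite integral0.
Qed.

Lemma integral_inv_sub (u a L : R) : 0 < a <= L ->
  (\int[leb]_(r in `[a, L]) (r^-1 - u * r ^- 2)%:E =
   (ln L + u / L - (ln a + u / a))%:E)%E.
Proof.
move=> /andP[a0 aL].
apply: (@integral_is_derive R _ (fun r => ln r + u * r^-1)) => // r /andP[ar rL].
  have r0 : 0 < r by exact: lt_le_trans ar.
  have dl := is_derive1_ln r0.
  have rn0 : r != 0 by rewrite gt_eqF.
  have dv := is_deriveV rn0 (is_derive_id r 1).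
  apply: is_derive_eq.
  by rewrite /GRing.scale/= mulr1 mulrN.
have r0 : 0 < r by exact: lt_le_trans ar.
have cV : {for r, continuous (fun r : R => r^-1)}.
  by apply: inv_continuous; rewrite gt_eqF.
apply: cvgB; first exact: cV.
apply: cvgM; first exact: cvg_cst.
under [X in X @ _ --> _]eq_fun do rewrite -exprVn expr2.
rewrite -exprVn expr2; apply: cvgM; exact: cV.
Qed.

(** With u = |x - y| <= L, integrating r^-1 - u r^-2 from u to L gives exactly - ln u + (ln L - 1) +
    u / L. For u >= L the kernel is 0 and the bound is ln (u / L) <= u / L - 1. *)
Lemma tentk_le L x y : 0 < L ->
  (tentk L x y + (`|x| + `|y|)%:E
     <= logk x y + (ln L - 1 + (`|x| + `|y|) / L)%:E)%E.
Proof.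
move=> L0; rewrite /logk; case: eqVneq => [->|xy].
  by rewrite addye// leey.
have u0 : 0 < `|x - y| by rewrite normr_gt0 subr_eq0.
have uL : `|x - y| / L <= (`|x| + `|y|) / L.
  by rewrite ler_pM2r ?invr_gt0//; exact: ler_normB.
rewrite tentkE; set u := `|x - y| in u0 uL *.
suff : (\int[leb]_(r in `]0%R, L]) (Num.max 0 (r^-1 - u * r ^- 2))%:E
    <= (- ln u + (ln L - 1) + u / L)%:E)%E.
  move=> h; apply: (le_trans (leeD h (lexx _))); rewrite -!EFinD lee_fin; lra.
have maxE r : 0 < r -> Num.max 0 (r^-1 - u * r ^- 2) =
    if r <= u then 0 else r^-1 - u * r ^- 2.
  move=> r0; have -> : r^-1 - u * r ^- 2 = r ^- 2 * (r - u).
    by field; rewrite gt_eqF.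
  have r2 : 0 < r ^- 2 by rewrite invr_gt0 exprn_gt0.
  case: ifPn => ru; first by rewrite max_l// pmulr_rle0//; lra.
  by rewrite max_r// pmulr_rge0//; rewrite -ltNge in ru; lra.
have [Lu|uL'] := leP L u.
  under eq_integral => r.
    rewrite inE/= in_itv/= => /andP[r0 rL].
    rewrite maxE// (le_trans rL Lu); over.
  rewrite integral0 lee_fin.
  have := @le_ln1Dx R (u / L - 1); rewrite subrKC ln_div ?posrE// => h.
  suff : -1 < u / L - 1 by move=> /h; lra.
  by rewrite ltrBrDl subrr divr_gt0.
have -> : (\int[leb]_(r in `]0%R, L]) (Num.max 0 (r^-1 - u * r ^- 2))%:E =
    \int[leb]_(r in `[u, L]) (r^-1 - u * r ^- 2)%:E)%E.
  rewrite integral_mkcond [RHS]integral_mkcond; apply: eq_integral => r _.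
  rewrite !patchE !mem_setE !in_itv/=.
  have [r0|r0] := ltP 0 r; last first.
    by rewrite (_ : u <= r = false)//; apply/negbTE; rewrite -ltNge (le_lt_trans r0).
  rewrite maxE//; case: (r <= L); rewrite ?andbF ?andbT//=.
  case: ltgtP => // ->.
  by rewrite expr2 invfM mulrA divff ?gt_eqF// mul1r subrr.
rewrite integral_inv_sub; last by rewrite u0 ltW.
by rewrite lee_fin divff ?gt_eqF//; lra.
Qed.

(** The reverse comparison drops u / L >= 0. For u > L, ln L - ln u is negative and the
    nonnegativity of [tentk] suffices. On the diagonal both sides must be +oo, so [low] keeps the
    lower limit a of integration free instead of fixing a = u. *)
Lemma logk_le_tentk L x y : 1 <= L ->
  (logk x y + (ln L - 1)%:E <= tentk L x y + (`|x| + `|y|)%:E)%E.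
Proof.
move=> L1; have L0 : 0 < L by exact: lt_le_trans L1.
have low a : `|x - y| <= a -> 0 < a <= L ->
    ((ln L + `|x - y| / L - (ln a + `|x - y| / a))%:E <= tentk L x y)%E.
  move=> ua /andP[a0 aL].
  rewrite tentkE -integral_inv_sub ?a0//.
  have mf : measurable_fun `]0%R, L]
      (fun r : R => (Num.max 0 (r^-1 - `|x - y| * r ^- 2))%:E).
    apply: (@eq_measurable_fun _ _ _ _ _
      (fun r : R => (Num.max 0 (expR (- ln r) - `|x - y| * (expR (- ln r)) ^+ 2))%:E)).
      move=> r; rewrite inE/= in_itv/= => /andP[r0 _].
      by rewrite expRN lnK ?posrE// exprVn.
    have me : measurable_fun `]0%R, L] (fun r : R => expR (- ln r)).
      apply: measurableT_comp => //; apply: measurableT_comp => //.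
      exact: measurable_funTS.
    apply/measurable_EFinP/measurable_maxr => //.
    apply: measurable_funB => //; apply: measurable_funM => //.
    exact: measurable_funX.
  have sub : `[a, L]%classic `<=` `]0, L]%classic.
    by move=> r /=; rewrite !in_itv/= => /andP[ar ->]; rewrite (lt_le_trans a0).
  apply: (@le_trans _ _ (\int[leb]_(r in `[a, L])
      (Num.max 0 (r^-1 - `|x - y| * r ^- 2))%:E)%E); last first.
    apply: ge0_subset_integral => //.
    by move=> r _; rewrite lee_fin le_max lexx.
  rewrite [leRHS](_ : _ = (\int[leb]_(r in `[a, L]) (r^-1 - `|x - y| * r ^- 2)%:E)%E)//.
  apply: eq_integral => r; rewrite inE/= in_itv/= => /andP[ar rL].
  have r0 : 0 < r by exact: lt_le_trans ar.
  rewrite max_r//; have -> : r^-1 - `|x - y| * r ^- 2 = r ^- 2 * (r - `|x - y|).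
    by field; rewrite gt_eqF.
  by rewrite mulr_ge0 ?invr_ge0 ?exprn_ge0 ?(ltW r0)//; lra.
have K0 : (0 <= tentk L x y)%E by exact: tentk_ge0.
rewrite /logk; case: eqVneq => [xy|xy].
  rewrite addye//.
  suff -> : tentk L x y = +oo%E by rewrite addye.
  apply/eqyP => M _.
  (* With x = y the lower bound is ln L - ln a; the choice a = L exp (- |M|) makes it |M|, so the
     kernel exceeds every M. *)
  have /low : `|x - y| <= L * expR (- `|M|) by rewrite xy subrr normr0 mulr_ge0 ?expR_ge0 ?ltW.
  have -> : 0 < L * expR (- `|M|) <= L.
    apply/andP; split; first by rewrite mulr_gt0 ?expR_gt0.
    rewrite -[leRHS]mulr1; apply: ler_wpM2l; first exact: ltW.
    by rewrite -expR0 ler_expR oppr_le0.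
  move=> /(_ isT); apply: le_trans; rewrite xy subrr normr0 !mul0r !addr0.
  rewrite lnM ?posrE ?expR_gt0// expRK lee_fin; have := ler_norm M; lra.
have u0 : 0 < `|x - y| by rewrite normr_gt0 subr_eq0.
have [uL|Lu] := leP `|x - y| L.
  have := low _ (lexx _); rewrite u0 uL => /(_ isT).
  rewrite divff ?gt_eqF// => h.
  apply: le_trans (leeD h (lexx _)).
  rewrite -!EFinD lee_fin.
  have : 0 <= `|x - y| / L by rewrite divr_ge0 ?ltW.
  lra.
apply: le_trans (leeD K0 (lexx _)); rewrite add0e -EFinD lee_fin.
have : ln L <= ln `|x - y| by rewrite ler_ln ?posrE// ltW.
lra.
Qed.

End log_kernel.

(** * Minimality from the Euler-Lagrange conditions *)

Section minimality.
Context {R : realType}.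
Implicit Types P Q : probability R R.

Lemma iint_abs P Q (p q A B : R) : 0 <= A -> 0 <= B ->
  (\int[P]_x `|x|%:E = p%:E)%E -> (\int[Q]_x `|x|%:E = q%:E)%E ->
  (iint P Q (fun x y => (A + B * (`|x| + `|y|))%:E) = (A + B * (p + q))%:E)%E.
Proof.
move=> A0 B0 pE qE.
have mB : measurable_fun setT (fun x : R => (B * `|x|)%:E).
  by apply/measurable_EFinP; apply: measurable_funM => //; exact: measurableT_comp.
have m1 : mfun2 (fun x _ : R => (B * `|x|)%:E) by exact: (measurableT_comp mB).
have m2 : mfun2 (fun _ y : R => (B * `|y|)%:E) by exact: (measurableT_comp mB).
have B1 (x : R) : (0 <= (B * `|x|)%:E)%E by rewrite lee_fin mulr_ge0.
have mA : mfun2 (fun _ _ : R => A%:E) by exact: measurable_cst.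
have m12 : mfun2 (fun x y : R => (B * `|x|)%:E + (B * `|y|)%:E)%E.
  exact: emeasurable_funD.
have e12 := iintD P Q m1 m2 (fun x _ => B1 x) (fun _ y => B1 y).
have eA := iintD P Q mA m12 (fun _ _ => A0) (fun x y => adde_ge0 (B1 x) (B1 y)).
have -> : (fun x y : R => (A + B * (`|x| + `|y|))%:E) =
    (fun x y => A%:E + ((B * `|x|)%:E + (B * `|y|)%:E))%E.
  by apply/funext => x; apply/funext => y; rewrite -!EFinD mulrDr.
rewrite eA e12.
rewrite iint_fst iint_fst iint_snd integral_cst_prob.
under eq_integral do rewrite EFinM.
rewrite ge0_integralZl//; last exact/measurable_EFinP.
under [X in (_ + (_ + X))%E]eq_integral do rewrite EFinM.
rewrite ge0_integralZl//; last exact/measurable_EFinP.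
by rewrite pE qE -!EFinM -!EFinD mulrDr.
Qed.

Lemma mfun2_affine_abs (A B : R) :
  mfun2 (fun x y : R => (A + B * (`|x| + `|y|))%:E).
Proof.
apply/measurable_EFinP; apply: measurable_funD => //; apply: measurable_funM => //.
by apply: measurable_funD; apply: measurableT_comp.
Qed.

(** Positivity of the truncated kernel is transferred by the two comparisons. The shifts |x| + |y|
    contribute 2 (p + q) to both sides and ln L - 1 occurs twice on each, so only the error 2 (p +
    q) / L remains. *)
Lemma logk_positive P Q :
  (\int[P]_x `|x|%:E < +oo)%E -> (\int[Q]_x `|x|%:E < +oo)%E ->
  (iint P Q logk + iint P Q logk <= iint P P logk + iint Q Q logk)%E.
Proof.
have mom0 (S : probability R R) : (0 <= \int[S]_x `|x|%:E)%E.
  by apply: integral_ge0 => x _; rewrite lee_fin.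
have := mom0 P; case pE : (\int[P]_x `|x|%:E)%E => [p||]// p0 _.
have := mom0 Q; case qE : (\int[Q]_x `|x|%:E)%E => [q||]// q0 _.
rewrite !lee_fin in p0 q0.
apply/lee_addgt0Pr => e e0.
(* The term exp 1 gives ln L - 1 >= 0, which keeps all compared functions nonnegative; the other
   term makes the truncation error at most e. *)
pose L := expR 1 + 2 * (p + q) / e.
have pq0 : 0 <= 2 * (p + q) / e by rewrite divr_ge0 ?(ltW e0)//; lra.
have L1 : expR 1 <= L by rewrite /L lerDl.
have L0 : 0 < L by apply: lt_le_trans L1; exact: expR_gt0.
have L11 : 1 <= L by apply: le_trans L1; rewrite -[leLHS]expR0 ler_expR.
have c0 : 0 <= ln L - 1.
  by rewrite subr_ge0 -[leLHS]expRK ler_ln ?posrE ?expR_gt0.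
have Le : 2 * (p + q) / L <= e.
  rewrite ler_pdivrMr// -ler_pdivrMl// mulrC /L; have := expR_ge0 (1 : R); lra.
have LV : 0 <= L^-1 by rewrite invr_ge0 ltW.
have lk0 (x y : R) : (0 <= logk x y)%E by exact: logk_ge0.
have ab0 (A B : R) : 0 <= A -> 0 <= B ->
    forall x y : R, (0 <= (A + B * (`|x| + `|y|))%:E)%E.
  by move=> A0 B0 x y; rewrite lee_fin addr_ge0// mulr_ge0// addr_ge0.
have mlk : mfun2 (@logk R) by exact: mfun2_logk.
have mtk := mfun2_tentk L; have tk0 := tentk_ge0 L.
have mab := mfun2_affine_abs.
have mlab A B : mfun2 (fun x y : R => logk x y + (A + B * (`|x| + `|y|))%:E)%E.
  exact: (emeasurable_funD mlk (mab A B)).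
have mtab A B : mfun2 (fun x y : R => tentk L x y + (A + B * (`|x| + `|y|))%:E)%E.
  exact: (emeasurable_funD mtk (mab A B)).
have tkl x y := tentk_le x y L0; have lkt x y := logk_le_tentk x y L11.
have pos : (iint P Q (tentk L) + iint P Q (tentk L) <=
    iint P P (tentk L) + iint Q Q (tentk L))%E.
  exact: gram_positive (measurable_tent L) (tent_ge0 L) P Q.
move: (tentk L) mtk tk0 mtab tkl lkt pos => K mtk tk0 mtab tkl lkt pos.
have low : (iint P Q logk + (ln L - 1)%:E <= iint P Q K + (p + q)%:E)%E.
  have := @le_iint _ _ R P Q
    (fun x y => logk x y + (ln L - 1 + 0 * (`|x| + `|y|))%:E)%E
    (fun x y => K x y + (0 + 1 * (`|x| + `|y|))%:E)%E (mlab _ _) (mtab _ _).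
  rewrite (iintD P Q mlk (mab _ _) lk0 (ab0 _ _ c0 (lexx 0))).
  rewrite (iintD P Q mtk (mab _ _) tk0 (ab0 _ _ (lexx 0) ler01)).
  rewrite (iint_abs c0 (lexx 0) pE qE) (iint_abs (lexx 0) ler01 pE qE).
  rewrite mul0r addr0 add0r mul1r; apply.
  - by move=> x y; rewrite adde_ge0 ?lk0// ab0.
  - by move=> x y; rewrite mul0r addr0 add0r mul1r; exact: lkt.
have upp (S : probability R R) s : (\int[S]_x `|x|%:E = s%:E)%E ->
    (iint S S K + (s + s)%:E
      <= iint S S logk + (ln L - 1 + L^-1 * (s + s))%:E)%E.
  move=> sE.
  have := @le_iint _ _ R S S
    (fun x y => K x y + (0 + 1 * (`|x| + `|y|))%:E)%E
    (fun x y => logk x y + (ln L - 1 + L^-1 * (`|x| + `|y|))%:E)%E (mtab _ _) (mlab _ _).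
  rewrite (iintD S S mtk (mab _ _) tk0 (ab0 _ _ (lexx 0) ler01)).
  rewrite (iintD S S mlk (mab _ _) lk0 (ab0 _ _ c0 LV)).
  rewrite (iint_abs (lexx 0) ler01 sE sE) (iint_abs c0 LV sE sE).
  rewrite add0r mul1r; apply.
  - by move=> x y; rewrite adde_ge0 ?tk0// ab0.
  - by move=> x y; rewrite add0r mul1r (mulrC L^-1); exact: tkl.
have := upp _ _ pE; have := upp _ _ qE; move: low pos.
have J0 (S S' : probability R R) : (0 <= iint S S' logk)%E.
  by apply: iint_ge0 => x y; exact: logk_ge0.
have K0 (S S' : probability R R) : (0 <= iint S S' K)%E by exact: iint_ge0.
have := J0 P P; have := J0 Q Q; have := J0 P Q.
have := K0 P P; have := K0 Q Q; have := K0 P Q.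
(* An infinite self-energy makes the claim trivial. Otherwise the comparisons force all remaining
   terms to be finite, and linear arithmetic concludes. *)
case: (iint P P logk) => [a1 | | ]; case: (iint Q Q logk) => [a2 | | ] //;
  try by move=> *; rewrite ?(addye, addey)// leey.
case: (iint P P K) => [b1 | | ] //; case: (iint Q Q K) => [b2 | | ] //.
case: (iint P Q K) => [b3 | | ] //; case: (iint P Q logk) => [a3 | | ] //.
rewrite -!EFinD !lee_fin.
have : L^-1 * (p + p) + L^-1 * (q + q) = 2 * (p + q) / L by ring.
lra.
Qed.

Lemma measurable_shifted_field (V : {poly R}) (C : R) :
  measurable_fun setT (fun x : R => (V.[x] / 2 - `|x| + C)%:E).
Proof.
apply/measurable_EFinP; apply: measurable_funD => //.
apply: measurable_funB; last exact: normr_measurable.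
apply: measurable_funM => //; apply: continuous_measurable_fun.
exact: continuous_horner.
Qed.

(** Write J for the pairing by [logk] and W = V / 2 - |x| + C; the energy of S is J(S, S) + 2 W(S) -
    2 C. The hypotheses give J(P, P) + W(P) <= e <= J(Q, P) + W(Q), and 2 J(Q, P) <= J(Q, Q) + J(P,
    P) yields minimality. The factor 4 ensures W >= |x| after the shift, so a competitor with
    infinite first moment has infinite energy and [logk_positive] applies to all the others. *)
Lemma equilibrium_of_potential (V : {poly R}) P (C e : R) : 0 <= C ->
  (forall x, 4 * `|x| - C <= V.[x]) ->
  (\int[P]_x `|x|%:E < +oo)%E ->
  (forall x, e%:E <= \int[P]_y logk x y + (V.[x] / 2 - `|x| + C)%:E)%E ->
  (\int[P]_x (\int[P]_y logk x y + (V.[x] / 2 - `|x| + C)%:E) <= e%:E)%E ->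
  is_equilibrium_measure V P.
Proof.
move=> C0 VC mP elP ePP Q.
pose W x : R := V.[x] / 2 - `|x| + C.
have W1 x : `|x| <= W x by rewrite /W; have := VC x; lra.
have W0 x : 0 <= W x by exact: le_trans (W1 x).
have mW : measurable_fun setT (EFin \o W).
  exact: measurable_shifted_field.
have mJ (S : probability R R) : measurable_fun setT (fun x => \int[S]_y logk x y)%E.
  by apply: mfun2_integral; [exact: mfun2_logk|exact: logk_ge0].
have J0 (S : probability R R) x : (0 <= \int[S]_y logk x y)%E.
  by apply: integral_ge0 => y _; exact: logk_ge0.
have energyE (S : probability R R) : (energy V S =
    iint S S logk + (\int[S]_x (W x)%:E + \int[S]_x (W x)%:E) - (2 * C)%:E)%E.
  have mW1 : mfun2 (fun x _ : R => (W x)%:E) by exact: (measurableT_comp mW).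
  have mW2 : mfun2 (fun _ y : R => (W y)%:E) by exact: (measurableT_comp mW).
  pose f x y := (logk x y + ((W x)%:E + (W y)%:E))%E.
  have mf : mfun2 f.
    by apply: emeasurable_funD; [exact: mfun2_logk|exact: emeasurable_funD].
  have f0 x y : (0 <= f x y)%E by rewrite adde_ge0 ?logk_ge0// -EFinD lee_fin addr_ge0.
  transitivity (iint S S f - (2 * C)%:E)%E.
    rewrite /iint -ge0_integralB_cst//; last 3 first.
    - exact: mfun2_integral.
    - by move=> x; exact: integral_ge0.
    - by rewrite mulr_ge0.
    apply: eq_integral => x _; rewrite -ge0_integralB_cst//; last 2 first.
    - exact: mfun2_section.
    - by rewrite mulr_ge0.
    apply: eq_integral => y _; rewrite /energy_kernel /f /logk.
    case: eqVneq => _; first by rewrite addye// addye.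
    by rewrite -!EFinD; congr EFin; rewrite /W; field.
  have W10 (x y : R) : (0 <= (W x)%:E)%E by rewrite lee_fin.
  have W20 (x y : R) : (0 <= (W y)%:E)%E by rewrite lee_fin.
  have e12 := iintD S S mW1 mW2 W10 W20.
  have eA := iintD S S mfun2_logk (emeasurable_funD mW1 mW2 : mfun2 (fun x y => (W x)%:E + (W y)%:E)%E)
    (@logk_ge0 R) (fun x y => adde_ge0 (W10 x y) (W20 x y)).
  by rewrite /f eA e12 iint_fst iint_snd.
rewrite !energyE; apply: leeB => //.
have sum (S : probability R R) :
    (\int[S]_x (\int[P]_y logk x y + (W x)%:E) = iint S P logk + \int[S]_x (W x)%:E)%E.
  by rewrite ge0_integralD// => x _; rewrite lee_fin.
have eQ : (e%:E <= iint Q P logk + \int[Q]_x (W x)%:E)%E.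
  rewrite -sum -[leLHS](integral_cst_prob Q).
  have [e0|e0] := leP 0 e.
    by apply: ge0_le_integral => //; exact: emeasurable_funD.
  rewrite integral_cst_prob; apply: (@le_trans _ _ 0%E); first by rewrite lee_fin ltW.
  by apply: integral_ge0 => x _; rewrite adde_ge0 ?J0// lee_fin.
move: ePP; rewrite sum.
have WS0 (S : probability R R) : (0 <= \int[S]_x (W x)%:E)%E.
  by apply: integral_ge0 => x _; rewrite lee_fin.
have JS0 (S S' : probability R R) : (0 <= iint S S' logk)%E.
  by apply: iint_ge0 => x y; exact: logk_ge0.
have [mQ|] := boolP (\int[Q]_x `|x|%:E < +oo)%E; last first.
  rewrite -leNgt leye_eq => /eqP mQ _.
  have -> : (\int[Q]_x (W x)%:E = +oo)%E.
    apply/eqP; rewrite -leye_eq -mQ; apply: ge0_le_integral => //.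
      exact/measurable_EFinP.
    by move=> x _; rewrite lee_fin.
  rewrite addye// addey ?leey//.
  by move: (JS0 Q Q); case: (iint Q Q logk).
have := logk_positive mQ mP; move: eQ.
have := WS0 Q; have := WS0 P.
have := JS0 Q Q; have := JS0 Q P; have := JS0 P P.
case: (iint Q Q logk) => [a1 | | ] //; last first.
  by move=> *; rewrite addye ?leey//; move: (WS0 Q); case: (\int[Q]_x (W x)%:E)%E.
case: (\int[Q]_x (W x)%:E)%E => [b1 | | ] //; last first.
  by move=> *; rewrite addye// addey// leey.
case: (iint P P logk) => [a2 | | ] //; case: (\int[P]_x (W x)%:E)%E => [b2 | | ] //.
case: (iint Q P logk) => [a3 | | ] //.
rewrite -!EFinD !lee_fin; lra.
Qed.

End minimality.

(** * Measures with a bounded density *)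

(** A point is Lebesgue null. This removes logarithmic singularities and mismatched interval ends
    below. *)
Lemma eq_integral_except1 (R : realType) (x : R) (f g : R -> \bar R) :
  measurable_fun setT f -> measurable_fun setT g ->
  (forall y, y != x -> f y = g y) ->
  (\int[lebesgue_measure]_y f y = \int[lebesgue_measure]_y g y)%E.
Proof.
move=> mf mg fg; apply: ae_eq_integral => //.
exists [set x]; split; [exact: measurable_set1|exact: lebesgue_measure_set1|].
move=> y /= h; apply: contrapT => yx; apply: h => _; apply: fg.
by apply/eqP => yx'; apply: yx.
Qed.

(** [nu] is dominated by [mu], and its Radon-Nikodym derivative agrees almost everywhere with w
    because both have the same integral over every measurable set. *)
Lemma ge0_integral_density d (T : measurableType d) (R : realType)
    (mu : {sigma_finite_measure set T -> \bar R})
    (nu : {finite_measure set T -> \bar R}) (w : T -> R) (f : T -> \bar R) :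
  measurable_fun setT w ->
  (forall A, measurable A -> nu A = \int[mu]_(x in A) (w x)%:E)%E ->
  measurable_fun setT f -> (forall x, (0 <= f x)%E) ->
  (\int[nu]_x f x = \int[mu]_x (f x * (w x)%:E))%E.
Proof.
move=> mw nuE mf f0.
have mwE : measurable_fun setT (EFin \o w) by exact/measurable_EFinP.
have numu : nu `<< mu.
  apply/null_content_dominatesP => A mA A0; rewrite nuE//; apply: null_set_integral => //.
  exact: measurable_funTS.
rewrite -(Radon_Nikodym_SigmaFinite.change_of_variables numu f0 measurableT mf).
have ig := Radon_Nikodym_SigmaFinite.f_integrable numu.
apply: ae_eq_integral => //.
- by apply: emeasurable_funM => //; exact: measurable_int ig.
- exact: emeasurable_funM.
apply: ae_eqe_mul2l; apply: integral_ae_eq => // A _ mA.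
by rewrite -Radon_Nikodym_SigmaFinite.f_integral// nuE.
Qed.

Lemma integral_density d (T : measurableType d) (R : realType)
    (mu : {sigma_finite_measure set T -> \bar R})
    (nu : {finite_measure set T -> \bar R}) (w : T -> R) (f : T -> \bar R) :
  measurable_fun setT w -> (forall x, 0 <= w x) ->
  (forall A, measurable A -> nu A = \int[mu]_(x in A) (w x)%:E)%E ->
  measurable_fun setT f ->
  (\int[nu]_x f x = \int[mu]_x (f x * (w x)%:E))%E.
Proof.
move=> mw w0 nuE mf; rewrite integralE [RHS]integralE.
rewrite !(ge0_integral_density mw nuE)//; last 2 first.
- exact: measurable_funeneg.
- exact: measurable_funepos.
congr (_ - _)%E; apply: eq_integral => x _; rewrite ?funeposE ?funenegE.
  have [->|] := eqVneq (w x) 0; first by rewrite !mule0 maxxx.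
  move=> wx; have wx0 : 0 < w x by rewrite lt_neqAle eq_sym wx w0.
  by rewrite maxe_pMl ?mul0e// ?lte_fin// ltW.
have [->|] := eqVneq (w x) 0; first by rewrite !mule0 oppe0 maxxx.
move=> wx; have wx0 : 0 < w x by rewrite lt_neqAle eq_sym wx w0.
by rewrite maxe_pMl ?mul0e ?mulNe// ?lte_fin// ltW.
Qed.

Lemma measurable_integral_pushforward d1 d2 (X : measurableType d1) (Y : measurableType d2)
    (R : realType) (phi : X -> Y) (mphi : measurable_fun setT phi)
    (mu : {measure set X -> \bar R}) (f : Y -> \bar R) : measurable_fun setT f ->
  (\int[pushforward_measure mu mphi]_y f y = \int[mu]_x f (phi x))%E.
Proof.
move=> mf.
have gE (g : Y -> \bar R) : measurable_fun setT g -> (forall x, 0 <= g x)%E ->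
    (\int[pushforward_measure mu mphi]_y g y = \int[mu]_x g (phi x))%E.
  by move=> mg g0; rewrite ge0_integral_pushforward.
rewrite [LHS]integralE [RHS]integralE; congr (_ - _)%E.
  rewrite (gE _ (measurable_funepos mf) (funepos_ge0 f)).
  by apply: eq_integral => y _; rewrite !funeposE.
rewrite (gE _ (measurable_funeneg mf) (funeneg_ge0 f)).
by apply: eq_integral => y _; rewrite !funenegE.
Qed.

(* [lebesgue_measure] lives on [measurableTypeR R], which carries the same
   sigma-algebra as [R] under a different display. *)
Lemma measurable_to_measurableTypeR (R : realType) :
  measurable_fun setT (idfun : R -> measurableTypeR R).
Proof. by move=> _ A mA; rewrite setTI preimage_id. Qed.

Lemma integral_lebesgue_density (R : realType) (P : probability R R) (w : R -> R)
    (f : R -> \bar R) :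
  measurable_fun setT w -> (forall y, 0 <= w y) ->
  (forall A : set R, measurable A -> (P A = \int[lebesgue_measure]_(x in A) (w x)%:E)%E) ->
  measurable_fun setT f ->
  (\int[P]_x f x = \int[lebesgue_measure]_x (f x * (w x)%:E))%E.
Proof.
move=> mw w0 PE mf.
have mi := @measurable_to_measurableTypeR R.
pose Q := pushforward_measure P mi.
have Qfin : fin_num_fun Q by move=> A mA; exact: fin_num_measure.
pose Qf := Measure_isFinite.Build _ _ _ Q Qfin.
pose Q' : {finite_measure set (measurableTypeR R) -> \bar R} :=
  HB.pack (Q : set (measurableTypeR R) -> \bar R) Q Qf.
have mf' : measurable_fun (setT : set (measurableTypeR R)) f by [].
transitivity (\int[Q]_x f x)%E.
  by rewrite (measurable_integral_pushforward mi P mf').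
exact: (@integral_density _ (measurableTypeR R) R lebesgue_measure Q').
Qed.

(** * Integrability of the logarithm against bounded densities *)

Section log_integrable.
Context {R : realType}.
Local Notation leb := (@lebesgue_measure R).

(** The negative part of [ln] on the positive reals. It isolates the singularity of the logarithmic
    kernel on one side of the diagonal. *)
Definition lnneg (u : R) : R := if 0 < u <= 1 then - ln u else 0.

Lemma lnneg_ge0 u : 0 <= lnneg u.
Proof. by rewrite /lnneg; case: ifP => // /andP[_ u1]; rewrite oppr_ge0 ln_le0. Qed.

Lemma measurable_lnneg : measurable_fun setT lnneg.
Proof.
apply: measurable_fun_ifT => //.
  by apply: measurable_and; [exact: measurable_fun_ltr|exact: measurable_fun_ler].
by apply: measurableT_comp => //; exact: measurable_ln.
Qed.

Lemma is_derive_xlnx (x : R) : 0 < x -> is_derive x 1 (fun x => x - x * ln x) (- ln x).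
Proof.
move=> x0; have dl := is_derive1_ln x0.
apply: is_derive_eq.
by rewrite /GRing.scale/= divff ?gt_eqF// mulr1; ring.
Qed.

(** Monotone exhaustion of ]0, 1] by [1 / (n + 1), 1]. The primitive x - x ln x gives 1 - q + q ln q
    <= 1 on [q, 1]. *)
Lemma integral_lnneg : (\int[leb]_u (lnneg u)%:E <= 1)%E.
Proof.
pose F (n : nat) : set (measurableTypeR R) := `[n.+1%:R^-1, 1]%classic.
have mF n : measurable (F n) by exact: measurable_itv.
have mE : measurable_fun setT (EFin \o lnneg).
  by apply/measurable_EFinP; exact: measurable_lnneg.
have UF : \bigcup_n F n = `]0, 1]%classic.
  apply/seteqP; split => [u [n _]|u]; rewrite /F /= !in_itv/=.
    by move=> /andP[nu ->]; rewrite andbT (lt_le_trans _ nu).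
  move=> /andP[u0 u1].
  have [n _ nu] : exists2 n, True & n.+1%:R^-1 <= u.
    exists (Num.truncn u^-1) => //.
    rewrite invf_ple ?posrE//; apply: ltW; apply: truncnS_gt.
  by exists n => //; rewrite /F/= in_itv/= nu u1.
have -> : (\int[leb]_u (lnneg u)%:E = \int[leb]_(u in \bigcup_n F n) (lnneg u)%:E)%E.
  rewrite UF [RHS]integral_mkcond; apply: eq_integral => u _.
  by rewrite patchE mem_setE in_itv/= /lnneg; case: ifP.
have nd : nondecreasing_seq F.
  move=> n m nm; rewrite subsetEset => u; rewrite /F/= !in_itv/= => /andP[nu ->].
  rewrite andbT (le_trans _ nu)// lef_pV2 ?posrE//.
  by rewrite ler_nat.
have cv := @ge0_nondecreasing_set_cvg_integral _ (measurableTypeR R) R F (EFin \o lnneg) leb nd mF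
  (fun i => measurable_funS measurableT (@subsetT _ _) mE)
  (fun i x _ => lnneg_ge0 x : (0 <= (lnneg x)%:E)%E).
rewrite -(cvg_lim _ cv)//; apply: lime_le; first by apply/cvg_ex; eexists; exact: cv.
apply: nearW => n /=.
have n0 : 0 < n.+1%:R^-1 :> R by [].
have n1 : n.+1%:R^-1 <= 1 :> R by rewrite invf_le1// ler1n.
rewrite (_ : (\int[leb]_(u in F n) _)%E = (\int[leb]_(u in `[n.+1%:R^-1%R, 1%R]) (- ln u)%:E)%E).
  have -> : (\int[leb]_(u in `[n.+1%:R^-1%R, 1%R]) (- ln u)%:E =
      ((1 - 1 * ln 1) - (n.+1%:R^-1 - n.+1%:R^-1 * ln n.+1%:R^-1))%:E)%E.
    apply: (@integral_is_derive R _ (fun x => x - x * ln x)) => //.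
      by move=> x /andP[nx _]; apply: is_derive_xlnx; exact: lt_le_trans nx.
    move=> x /andP[nx _]; apply: continuousN; apply: continuous_ln.
    exact: lt_le_trans nx.
  rewrite lee_fin ln1 mulr0 subr0.
  have : n.+1%:R^-1 * ln n.+1%:R^-1 <= 0 :> R by rewrite mulr_ge0_le0 ?ln_le0// ltW.
  by move: n0; move: (_ * ln _) => p; move: (n.+1%:R^-1) => q; lra.
apply: eq_integral => u; rewrite mem_setE in_itv/= /lnneg => /andP[nu ->].
by rewrite (lt_le_trans n0 nu).
Qed.

Lemma integrable_lnneg : leb.-integrable setT (EFin \o lnneg).
Proof.
apply/integrableP; split; first by apply/measurable_EFinP; exact: measurable_lnneg.
apply: le_lt_trans (ltry 1); apply: le_trans integral_lnneg.
rewrite le_eqVlt; apply/orP; left; apply/eqP; apply: eq_integral => x _ /=.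
by rewrite ger0_norm// lnneg_ge0.
Qed.

(** The two one-sided terms absorb the singularity at 0, and ln v <= v the growth at infinity. *)
Lemma norm_ln_le (u : R) : `|ln `|u| | <= lnneg u + lnneg (- u) + `|u|.
Proof.
have pos v : 0 < v -> `|ln v| <= lnneg v + v.
  move=> v0; rewrite /lnneg v0/=; case: (leP v 1) => v1.
    by rewrite ler0_norm ?ln_le0//; lra.
  by rewrite add0r ger0_norm ?ln_ge0 ?ltW//; exact: ln_sublinear.
have [u0|u0|->] := ltgtP u 0.
- have := pos (- u); rewrite oppr_gt0 => /(_ u0) p.
  rewrite (ltr0_norm u0); apply: le_trans p _.
  by rewrite lerD2r lerDr lnneg_ge0.
- rewrite (gtr0_norm u0); apply: le_trans (pos _ u0) _.
  by rewrite lerD2r lerDl lnneg_ge0.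
- rewrite normr0 ln0// normr0 addr0 addr_ge0//; exact: lnneg_ge0.
Qed.

Lemma measurable_ln_norm_sub (x : R) : measurable_fun setT (fun y : R => ln `|x - y|).
Proof.
apply: measurableT_comp; first exact: measurable_ln.
by apply: measurableT_comp => //; exact: measurable_funB.
Qed.

Section bounded_density.
Variables (w : R -> R) (M c : R).
Hypotheses (mw : measurable_fun setT w) (w0 : forall y, 0 <= w y).
Hypotheses (wM : forall y, w y <= M) (wc : forall y, c < `|y| -> w y = 0).

Let M0 : 0 <= M. Proof. exact: le_trans (w0 0) (wM 0). Qed.

(** The majorant is M times two translated copies of [lnneg], one reflected, plus the constant (|x|
    + |c|) M on [- c, c], where |x - y| <= |x| + |c|. *)
Lemma integrable_ln_density (x : R) :
  leb.-integrable setT (fun y => (ln `|x - y| * w y)%:E).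
Proof.
have i1 := integrable_affine (- x) (oner_neq0 R) integrable_lnneg.
have i2 : leb.-integrable setT (fun y => (EFin \o lnneg) (-1 * y + x)).
  by apply: integrable_affine integrable_lnneg; rewrite oppr_eq0 oner_neq0.
have i3 := integrable_indic_itv (- c) c true false.
have i4 : leb.-integrable setT (fun y : R => (M%:E * ((lnneg (1 * y - x))%:E + (lnneg (-1 * y + x))%:E)
   + ((`|x| + `|c|) * M)%:E * (\1_(`[- c, c]%classic : set R) y)%:E)%E).
  apply: integrableD => //.
    by apply: integrableZl => //; apply: integrableD.
  by apply: integrableZl.
apply: le_integrable i4 => //.
  by apply/measurable_EFinP; apply: measurable_funM => //; exact: measurable_ln_norm_sub.
move=> y _; rewrite -!EFinD !abse_EFin lee_fin.
rewrite normrM (ger0_norm (w0 y)).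
rewrite [leRHS]ger0_norm; last first.
  by rewrite addr_ge0 ?mulr_ge0 ?addr_ge0 ?lnneg_ge0.
have h := norm_ln_le (x - y).
have l1 := lnneg_ge0 (x - y); have l2 := lnneg_ge0 (- (x - y)).
have -> : 1 * y - x = - (x - y) by ring.
have -> : -1 * y + x = x - y by ring.
rewrite indicE mem_setE in_itv/=.
case: (leP `|y| c) => yc; last first.
  by rewrite wc// mulr0 addr_ge0 ?mulr_ge0 ?addr_ge0.
move: (yc); rewrite ler_norml => ->; rewrite mulr1.
have hxy : `|x - y| <= `|x| + `|c|.
  by apply: le_trans (ler_normB _ _) _; rewrite lerD2l (le_trans yc)// ler_norm.
apply: (@le_trans _ _ ((lnneg (x - y) + lnneg (- (x - y)) + (`|x| + `|c|)) * M)).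
  by apply: ler_pM => //; apply: le_trans h _; rewrite lerD2l.
by rewrite le_eqVlt; apply/orP; left; apply/eqP; ring.
Qed.

Lemma integrable_abs_density : leb.-integrable setT (fun y => (`|y| * w y)%:E).
Proof.
have i3 := integrable_indic_itv (- c) c true false.
have i4 : leb.-integrable setT (fun y : R =>
   ((`|c| * M)%:E * (\1_(`[- c, c]%classic : set R) y)%:E)%E).
  by apply: integrableZl.
apply: le_integrable i4 => //.
  by apply/measurable_EFinP; apply: measurable_funM => //.
move=> y _; rewrite -?EFinM !abse_EFin lee_fin indicE mem_setE in_itv/=.
case: (leP `|y| c) => yc; last by rewrite wc// mulr0 normr0.
move: (yc); rewrite ler_norml => ->; rewrite mulr1 !normrM !normr_id.
rewrite (ger0_norm (w0 y)) (ger0_norm M0) ler_pM//.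
by rewrite (le_trans yc)// ler_norm.
Qed.

(** Real-valued counterpart of [log_potential]: at y = x it uses ln 0 = 0 instead of -oo, which
    differs on a null set only. *)
Definition pot (x : R) : R := \int[leb]_y (ln `|x - y| * w y).

Definition mom : R := \int[leb]_y (`|y| * w y).

Lemma potE x : (\int[leb]_y (ln `|x - y| * w y)%:E = (pot x)%:E)%E.
Proof. by rewrite /pot /Rintegral fineK//; exact: integrable_fin_num (integrable_ln_density x). Qed.

Lemma momE : (\int[leb]_y (`|y| * w y)%:E = mom%:E)%E.
Proof. by rewrite /mom /Rintegral fineK//; exact: integrable_fin_num integrable_abs_density. Qed.

Variable P : probability R R.
Hypothesis PE : forall A : set R, measurable A ->
  (P A = \int[leb]_(x in A) (w x)%:E)%E.

Lemma log_potential_density x : log_potential P x = (pot x)%:E.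
Proof.
rewrite -potE /log_potential (integral_lebesgue_density mw w0 PE); last first.
  apply: measurable_fun_ifT => //; first exact: measurable_fun_eqr.
  by apply/measurable_EFinP; exact: measurable_ln_norm_sub.
apply: (@eq_integral_except1 _ x).
- apply: emeasurable_funM; last exact/measurable_EFinP.
  apply: measurable_fun_ifT => //; first exact: measurable_fun_eqr.
  by apply/measurable_EFinP; exact: measurable_ln_norm_sub.
- by apply/measurable_EFinP; apply: measurable_funM => //; exact: measurable_ln_norm_sub.
- by move=> y /negbTE ->.
Qed.

Lemma moment_density : (\int[P]_x `|x|%:E = mom%:E)%E.
Proof.
rewrite -momE (integral_lebesgue_density mw w0 PE); first by apply: eq_integral => y _; rewrite -EFinM.
exact/measurable_EFinP.
Qed.

(** Translates between the shifted kernel of the minimality argument and the potential of the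
    Euler-Lagrange conditions. *)
Lemma logk_density x : (\int[P]_y logk x y = (`|x| + mom - pot x)%:E)%E.
Proof.
have w1 : (\int[leb]_y (w y)%:E = 1)%E by rewrite -PE//; exact: probability_setT.
have iw : leb.-integrable setT (EFin \o w).
  apply/integrableP; split; first exact/measurable_EFinP.
  under eq_integral do rewrite /= ger0_norm//.
  by rewrite w1 ltry.
have ml : measurable_fun setT (logk x) by apply: mfun2_section; exact: mfun2_logk.
rewrite (integral_lebesgue_density mw w0 PE)//.
have ix : leb.-integrable setT (fun y => `|x|%:E * (w y)%:E)%E by exact: integrableZl.
have := integrableB measurableT (integrableD measurableT ix integrable_abs_density)
  (integrable_ln_density x).
move=> i.
transitivity (\int[leb]_y ((`|x|%:E * (w y)%:E + (`|y| * w y)%:E)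
     - (ln `|x - y| * w y)%:E))%E.
  apply: (@eq_integral_except1 _ x); [|exact: measurable_int i|].
    by apply: emeasurable_funM => //; exact/measurable_EFinP.
  move=> y yx; rewrite /logk eq_sym (negbTE yx) -!EFinM -!EFinD.
  by congr EFin; ring.
have e1 := integralB measurableT (integrableD measurableT ix integrable_abs_density)
  (integrable_ln_density x).
have e2 := integralD measurableT ix integrable_abs_density.
have e3 := integralZl measurableT iw `|x|.
have /= -> := e1; have /= -> := e2; have /= -> := e3.
by rewrite w1 mule1 potE momE -!EFinD.
Qed.

End bounded_density.
End log_integrable.

(** * One-cut data *)

Section density_probability.
Context {R : realType}.
Local Notation leb := (@lebesgue_measure R).

Section density.
Variable w : R -> R.
Hypotheses (mw : measurable_fun setT w) (w0 : forall y, 0 <= w y).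
Hypothesis w1 : (\int[leb]_y (w y)%:E = 1)%E.

(** The proofs are part of the term so that the measure and probability structures can be attached
    to it. *)
Definition density_measure of measurable_fun setT w & (forall y, 0 <= w y) &
    (\int[leb]_y (w y)%:E = 1)%E := fun A : set R => (\int[leb]_(y in A) (w y)%:E)%E.

Let m := density_measure mw w0 w1.

Let m0 : m set0 = 0%E.
Proof. by rewrite /m /density_measure integral_set0. Qed.

Let m_ge0 A : (0 <= m A)%E.
Proof. by apply: integral_ge0 => y _; rewrite lee_fin. Qed.

Let m_sigma_additive : semi_sigma_additive m.
Proof.
move=> A mA tA mUA; rewrite /m /density_measure integral_bigcup//.
  by apply: is_cvg_ereal_nneg_natsum_cond => n _ _; exact: m_ge0.
apply/integrableP; split; first by apply/measurable_EFinP; exact: measurable_funTS.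
under eq_integral do rewrite /= ger0_norm//.
apply: (@le_lt_trans _ _ 1%E); last exact: ltry.
rewrite -w1; apply: ge0_subset_integral => //; first exact/measurable_EFinP.
by move=> y _; rewrite lee_fin.
Qed.

HB.instance Definition _ := isMeasure.Build _ _ _ m m0 m_ge0 m_sigma_additive.

Let m_setT : m setT = 1%E. Proof. exact: w1. Qed.

HB.instance Definition _ := @Measure_isProbability.Build _ _ R m m_setT.

Lemma density_probability : exists P : probability R R,
  forall A : set R, measurable A -> (P A = \int[leb]_(y in A) (w y)%:E)%E.
Proof. by exists m. Qed.

End density.

(** The factor 1 / c and the absolute value of h in the definition of regularity are absorbed into a
    polynomial positive on [a, b]. The density is then linear in h. *)
Definition one_cut_density (a b : R) (h : {poly R}) (y : R) : R :=
  if a <= y <= b then Num.sqrt `|(y - a) * (y - b)| * h.[y] else 0.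

Section one_cut_density.
Variables (a b : R) (h : {poly R}).
Hypotheses (ab : a < b) (h0 : forall y, a <= y <= b -> 0 < h.[y]).
Local Notation w := (one_cut_density a b h).

Lemma one_cut_density_ge0 y : 0 <= w y.
Proof.
rewrite /one_cut_density; case: ifP => // /h0 hy.
by rewrite mulr_ge0 ?sqrtr_ge0// ltW.
Qed.

Lemma continuous_sqrt_horner :
  continuous (fun y : R => Num.sqrt `|(y - a) * (y - b)| * h.[y]).
Proof.
move=> y; apply: cvgM; last exact: continuous_horner.
apply: continuous_comp; last exact: sqrt_continuous.
apply: continuous_comp; last exact: norm_continuous.
by apply: cvgM; apply: cvgB; by [exact: cvg_id|exact: cvg_cst].
Qed.

Lemma measurable_one_cut_density : measurable_fun setT w.
Proof.
apply: measurable_fun_ifT => //.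
  by apply: measurable_and; exact: measurable_fun_ler.
exact: continuous_measurable_fun continuous_sqrt_horner.
Qed.

Lemma one_cut_density_bounded : exists M, forall y, w y <= M.
Proof.
have [c _ cM] := EVT_max (ltW ab)
  (continuous_subspaceT continuous_sqrt_horner : {within `[a, b], continuous _}).
exists (Num.max 0 (Num.sqrt `|(c - a) * (c - b)| * h.[c])) => y.
rewrite /one_cut_density; case: ifP => yab; last by rewrite le_max lexx.
by rewrite le_max cM ?orbT// in_itv.
Qed.

Lemma one_cut_density_support y : `|a| + `|b| < `|y| -> w y = 0.
Proof.
move=> yab; rewrite /one_cut_density; case: ifP => // /andP[ay yb].
exfalso; move: yab; have := ler_norm b; have := ler_norm (- a); rewrite normrN.
by have := normr_ge0 a; have := normr_ge0 b; case: (ger0P y) => _; lra.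
Qed.

Lemma integral_one_cut_density_gt0 (c d : R) : a <= c -> c < d -> d <= b ->
  (0 < \int[leb]_(y in `]c, d[) (w y)%:E)%E.
Proof.
move=> ac cd db.
(* The middle third stays away from a and b, where the square root vanishes, so the continuous
   density has a positive minimum on it. *)
pose c' := (2 * c + d) / 3; pose d' := (c + 2 * d) / 3.
have cc' : c < c' by rewrite /c'; lra.
have cd' : c' < d' by rewrite /c' /d'; lra.
have dd' : d' < d by rewrite /d'; lra.
have [e /[!in_itv]/= /andP[ce ed] eM] := EVT_min (ltW cd')
  (continuous_subspaceT continuous_sqrt_horner : {within `[c', d'], continuous _}).
pose k := Num.sqrt `|(e - a) * (e - b)| * h.[e].
have k0 : 0 < k.
  rewrite /k mulr_gt0 ?h0//; last by apply/andP; split; lra.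
  rewrite sqrtr_gt0 normr_gt0 mulf_neq0// subr_eq0.
    by rewrite gt_eqF//; lra.
  by rewrite lt_eqF//; lra.
apply: (@lt_le_trans _ _ (\int[leb]_(y in `[c', d']) k%:E)%E).
  rewrite integral_cst//= lebesgue_measure_itv/= lte_fin cd' -EFinB -EFinM lte_fin.
  by rewrite mulr_gt0// subr_gt0.
have mw : measurable_fun setT (fun y => (w y)%:E).
  by apply/measurable_EFinP; exact: measurable_one_cut_density.
apply: (@le_trans _ _ (\int[leb]_(y in `[c', d']) (w y)%:E)%E).
  apply: ge0_le_integral => //.
  - by move=> y _; rewrite lee_fin ltW.
  - exact: measurable_funTS.
  - move=> y /=; rewrite in_itv/= => yi; rewrite lee_fin /one_cut_density.
    rewrite (_ : a <= y <= b); first by apply: eM; rewrite in_itv.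
    by case/andP: yi => ? ?; apply/andP; split; lra.
apply: ge0_subset_integral => //.
- exact: measurable_funTS.
- by move=> y _; rewrite lee_fin one_cut_density_ge0.
- by move=> y /=; rewrite !in_itv/= => /andP[? ?]; apply/andP; split; lra.
Qed.

End one_cut_density.

(** The part of one-cut regularity that is stable under interpolation: a normalized density together
    with the Euler-Lagrange conditions, stated with real-valued potentials. *)
Definition one_cut_data (V : {poly R}) (a b : R) (h : {poly R}) : Prop :=
  [/\ a < b, forall y, a <= y <= b -> 0 < h.[y],
      (\int[leb]_y (one_cut_density a b h y)%:E = 1)%E &
      exists l : R,
        (forall x, a <= x <= b -> 2 * pot (one_cut_density a b h) x - V.[x] = l) /\
        (forall x, ~ (a <= x <= b) -> 2 * pot (one_cut_density a b h) x - V.[x] < l)].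

(** By the intermediate value theorem a polynomial without zeros on an interval has constant sign
    there. This is what permits removing the absolute value around h. *)
Lemma horner_pos_or_neg (a b : R) (h : {poly R}) : a <= b ->
  (forall x, a <= x <= b -> h.[x] != 0) ->
  (forall x, a <= x <= b -> 0 < h.[x]) \/ (forall x, a <= x <= b -> 0 < (- h).[x]).
Proof.
move=> ab h0.
wlog ha : h h0 / 0 < h.[a] => [H|].
  have : h.[a] != 0 by apply: h0; rewrite lexx.
  rewrite neq_lt => /orP[ha|/(H _ h0)//].
  have [|||] := H (- h); rewrite ?opprK ?hornerN ?oppr_gt0//; last by left.
    by move=> x xab; rewrite hornerN oppr_eq0 h0.
  by right.
left=> x /andP[ax xb]; rewrite ltNge; apply/negP => hx.
have [|y /andP[ay yx]] := @poly_ivt R (- h) a x ax.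
  by rewrite !hornerN oppr_le0 oppr_ge0 hx ltW.
rewrite rootE hornerN oppr_eq0 => hy; move: (h0 y).
by rewrite hy ay (le_trans yx xb) => /(_ isT).
Qed.

Lemma one_cut_data_of_regular (V : {poly R}) :
  one_cut_regular V -> exists a b h, one_cut_data V a b h.
Proof.
move=> [P [_ [a [b [c [h [[ab _] c0 hn0 PE [l [lin lout]]]]]]]]].
have [k k0 wE] : exists2 k : {poly R}, (forall y, a <= y <= b -> 0 < k.[y]) &
    forall y, (if a <= y <= b then c^-1 * Num.sqrt `|(y - a) * (y - b)| * `|h.[y]| else 0)
      = one_cut_density a b k y.
  have c1 : 0 < c^-1 by rewrite invr_gt0.
  have [hp|hp] := horner_pos_or_neg (ltW ab) hn0.
    exists (c^-1 *: h) => y; first by move=> /hp hy; rewrite hornerZ mulr_gt0.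
    rewrite /one_cut_density; case: ifP => // /hp hy.
    by rewrite hornerZ (gtr0_norm hy); ring.
  exists (- c^-1 *: h) => y.
    by move=> /hp hy; rewrite hornerZ mulNr -mulrN mulr_gt0// -hornerN.
  rewrite /one_cut_density; case: ifP => // /hp.
  by rewrite hornerN oppr_gt0 hornerZ => hy; rewrite (ltr0_norm hy); ring.
have PE' (A : set R) : measurable A ->
    (P A = \int[leb]_(y in A) (one_cut_density a b k y)%:E)%E.
  by move=> mA; rewrite PE//; apply: eq_integral => y _; rewrite wE.
exists a, b, k; split => //; first by rewrite -PE'//; exact: probability_setT.
have [M wM] := one_cut_density_bounded k ab.
have lpE := log_potential_density (measurable_one_cut_density a b k)
  (one_cut_density_ge0 k0) wM (@one_cut_density_support a b k) PE'.
exists l; split=> x xab.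
  have := lin _ xab; rewrite lpE -EFinM -EFinB; exact: EFin_inj.
by have := lout _ xab; rewrite lpE -EFinM -EFinB lte_fin.
Qed.

Lemma oitvE (x e : R) : oitv x e = `]x - e, x + e[%classic.
Proof. by apply/seteqP; split=> y; rewrite /oitv /= in_itv. Qed.

Lemma regular_of_one_cut_data (V : {poly R}) (a b C : R) (h : {poly R}) :
  0 <= C -> (forall x, 4 * `|x| - C <= V.[x]) ->
  one_cut_data V a b h -> one_cut_regular V.
Proof.
move=> C0 VC [ab h0 w1 [l [lin lout]]].
have w0 := one_cut_density_ge0 h0.
have mw := measurable_one_cut_density a b h.
have [P PE] := density_probability mw w0 w1.
have [M wM] := one_cut_density_bounded h ab.
have ws := @one_cut_density_support a b h.
have lkE := logk_density mw w0 wM ws PE.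
have lpE := log_potential_density mw w0 wM ws PE.
exists P; split.
  (* By [logk_density], the effective potential is [mom] + C - (2 [pot] - V) / 2. It equals [mom] -
     l / 2 + C on [a, b] and is larger elsewhere. *)
  apply: (@equilibrium_of_potential R V P C (mom (one_cut_density a b h) - l / 2 + C)) => //.
  - by rewrite (moment_density mw w0 wM ws PE) ltry.
  - move=> x; rewrite lkE -EFinD lee_fin.
    have : 2 * pot (one_cut_density a b h) x - V.[x] <= l.
      by case: (boolP (a <= x <= b)) => [/lin ->//|/negP /lout /ltW].
    lra.
  - rewrite (integral_lebesgue_density mw w0 PE); last first.
      apply: emeasurable_funD; last exact: measurable_shifted_field.
      by apply: mfun2_integral; [exact: mfun2_logk|exact: logk_ge0].
    set e := (X in (_ <= X%:E)%E).
    have onE x : a <= x <= b ->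
        (\int[P]_y logk x y + (V.[x] / 2 - `|x| + C)%:E = e%:E)%E.
      by move=> /lin xl; rewrite lkE -EFinD; congr EFin; rewrite /e; lra.
    have e0 : (0 <= e%:E)%E.
      have := onE a; rewrite lexx (ltW ab) => /(_ isT) <-; apply: adde_ge0.
        by apply: integral_ge0 => y _; exact: logk_ge0.
      by rewrite lee_fin; have := VC a; have := normr_ge0 a; lra.
    apply: (@le_trans _ _ (\int[leb]_y (e%:E * (one_cut_density a b h y)%:E))%E).
      rewrite le_eqVlt; apply/orP; left; apply/eqP; apply: eq_integral => x _.
       have [xab|xab] := boolP (a <= x <= b); first by rewrite onE.
      by rewrite /one_cut_density (negbTE xab) !mule0.
    rewrite ge0_integralZl//.
    + by rewrite w1 mule1.
    + exact/measurable_EFinP.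
    + by move=> y _; rewrite lee_fin.
exists a, b, 1, h; split => //.
- split=> //; apply/seteqP; split=> x /=.
    move=> xs; rewrite in_itv/=; apply/andP; split; rewrite leNgt; apply/negP => xab.
      have := xs (a - x); rewrite subr_gt0 => /(_ xab).
      rewrite PE; last first.
        by rewrite oitvE; exact: measurable_itv.
      under eq_integral => y.
        rewrite inE /oitv/= => /andP[_ ya].
        rewrite /one_cut_density ifF; last by apply/negbTE/negP => /andP[]; lra.
        over.
      by rewrite integral0 ltxx.
    have := xs (x - b); rewrite subr_gt0 => /(_ xab).
    rewrite PE; last first.
      by rewrite oitvE; exact: measurable_itv.
    under eq_integral => y.
      rewrite inE /oitv/= => /andP[ya _].
      rewrite /one_cut_density ifF; last by apply/negbTE/negP => /andP[]; lra.
      over.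
    by rewrite integral0 ltxx.
  rewrite in_itv/= => /andP[ax xb] e e0.
  rewrite oitvE PE//.
  (* Every neighbourhood of a point of [a, b], endpoints included, meets ]a, b[ in a nonempty open
     interval, which has positive mass. *)
  pose c := Num.max a (x - e); pose d := Num.min b (x + e).
  have ac : a <= c by rewrite le_max lexx.
  have db : d <= b by rewrite ge_min lexx.
  have cd : c < d.
    by rewrite gt_max !lt_min ab /=; apply/andP; split; [|apply/andP; split]; lra.
  apply: lt_le_trans (integral_one_cut_density_gt0 h0 ac cd db) _.
  apply: ge0_subset_integral => //.
  + by apply/measurable_EFinP; exact: measurable_funTS.
  + by move=> y _; rewrite lee_fin.
  + by move=> y /=; rewrite !in_itv/= gt_max lt_min => /andP[/andP[_ ->] /andP[_ ->]].
- by move=> x /h0 hx; rewrite gt_eqF.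
- move=> A mA; rewrite PE//; apply: eq_integral => y _.
  rewrite /one_cut_density invr1 mul1r; case: ifP => // /h0 hy.
  by rewrite (gtr0_norm hy).
- exists l; split=> x xab; rewrite lpE -EFinM -EFinB; first by rewrite lin.
  by rewrite lte_fin lout.
Qed.

End density_probability.

(** * Convex combinations and affine images of one-cut data *)

Section one_cut_data_operations.
Context {R : realType}.
Local Notation leb := (@lebesgue_measure R).
Implicit Types (V h : {poly R}) (a b : R).

Lemma integrable_ln_one_cut a b h x : a < b -> (forall y, a <= y <= b -> 0 < h.[y]) ->
  leb.-integrable setT (fun y => (ln `|x - y| * one_cut_density a b h y)%:E).
Proof.
move=> ab h0; have [M wM] := one_cut_density_bounded h ab.
exact: integrable_ln_density (measurable_one_cut_density a b h)
  (one_cut_density_ge0 h0) wM (@one_cut_density_support _ a b h) x.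
Qed.

Lemma pot_one_cutE a b h x : a < b -> (forall y, a <= y <= b -> 0 < h.[y]) ->
  (\int[leb]_y (ln `|x - y| * one_cut_density a b h y)%:E =
   (pot (one_cut_density a b h) x)%:E)%E.
Proof.
move=> ab h0; have [M wM] := one_cut_density_bounded h ab.
exact: potE (measurable_one_cut_density a b h)
  (one_cut_density_ge0 h0) wM (@one_cut_density_support _ a b h) x.
Qed.

Lemma one_cut_densityD a b h0 h1 (s t y : R) :
  one_cut_density a b (s *: h0 + t *: h1) y =
  s * one_cut_density a b h0 y + t * one_cut_density a b h1 y.
Proof.
rewrite /one_cut_density; case: ifP => _; last by rewrite !mulr0 addr0.
by rewrite hornerD !hornerZ; ring.
Qed.

Lemma one_cut_data_convex V0 V1 a b h0 h1 (s : R) : 0 <= s <= 1 ->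
  one_cut_data V0 a b h0 -> one_cut_data V1 a b h1 ->
  one_cut_data ((1 - s) *: V0 + s *: V1) a b ((1 - s) *: h0 + s *: h1).
Proof.
move=> /andP[s0 s1] [ab h00 m0 [l0 [in0 out0]]] [_ h10 m1 [l1 [in1 out1]]].
have t0 : 0 <= 1 - s by rewrite subr_ge0.
(* Serves twice: for the positivity of the combined h and for the strict gap outside [a, b]. *)
have conv_gt0 (x y : R) : 0 < x -> 0 < y -> 0 < (1 - s) * x + s * y.
  move=> x0 y0; have [->|sn0] := eqVneq s 0; first by rewrite subr0 mul1r mul0r addr0.
  have sp : 0 < s by rewrite lt_neqAle eq_sym sn0.
  by rewrite ltr_wpDl ?mulr_ge0 ?(ltW x0)// mulr_gt0.
have hpos y : a <= y <= b -> 0 < ((1 - s) *: h0 + s *: h1).[y].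
  by move=> yab; rewrite hornerD !hornerZ conv_gt0 ?h00 ?h10.
have mE h : measurable_fun (setT : set (measurableTypeR R))
    (fun y => (one_cut_density a b h y)%:E).
  by apply/measurable_EFinP; exact: measurable_one_cut_density.
have potD x : pot (one_cut_density a b ((1 - s) *: h0 + s *: h1)) x =
    (1 - s) * pot (one_cut_density a b h0) x + s * pot (one_cut_density a b h1) x.
  apply: EFin_inj; rewrite -pot_one_cutE// EFinD !EFinM.
  have i0 := integrable_ln_one_cut x ab h00; have i1 := integrable_ln_one_cut x ab h10.
  rewrite -(pot_one_cutE x ab h00) -(pot_one_cutE x ab h10).
  rewrite -(integralZl measurableT i0) -(integralZl measurableT i1).
  rewrite -(integralD measurableT (integrableZl measurableT (1 - s) i0)
     (integrableZl measurableT s i1)).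
  apply: eq_integral => y _ /=.
  by rewrite -!EFinM -EFinD one_cut_densityD; congr EFin; ring.
split=> //.
  under eq_integral do rewrite one_cut_densityD EFinD !EFinM.
  rewrite ge0_integralD//; last 4 first.
  - by move=> y _; rewrite -EFinM lee_fin mulr_ge0// one_cut_density_ge0.
  - exact: (emeasurable_funM (measurable_cst _) (mE _)).
  - by move=> y _; rewrite -EFinM lee_fin mulr_ge0// one_cut_density_ge0.
  - exact: (emeasurable_funM (measurable_cst _) (mE _)).
  rewrite !ge0_integralZl//; last 2 first.
  - by move=> y _; rewrite lee_fin one_cut_density_ge0.
  - by move=> y _; rewrite lee_fin one_cut_density_ge0.
  by rewrite m0 m1 !mule1 -EFinD subrK.
exists ((1 - s) * l0 + s * l1); split=> x xab; rewrite potD hornerD !hornerZ.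
  by rewrite -(in0 x xab) -(in1 x xab); ring.
rewrite -subr_gt0.
set p0 := pot _ x in out0 *; set p1 := pot (one_cut_density a b h1) x.
have o0 : 0 < l0 - (2 * p0 - V0.[x]) by rewrite subr_gt0; exact: out0.
have o1 : 0 < l1 - (2 * p1 - V1.[x]) by rewrite subr_gt0; exact: out1.
by have := conv_gt0 _ _ o0 o1; congr (0 < _); ring.
Qed.

Definition affine (r u : R) : {poly R} := r *: 'X + u%:P.

Lemma horner_affine (r u x : R) : (affine r u).[x] = r * x + u.
Proof. by rewrite /affine hornerD hornerZ hornerX hornerC. Qed.

(** Of the factor r^2, one r compensates the rescaling of the square root and the other is the
    Jacobian of the change of variable. *)
Lemma one_cut_density_affine a b h (r u y : R) : 0 < r ->
  one_cut_density ((a - u) / r) ((b - u) / r) (r ^+ 2 *: (h \Po affine r u)) y =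
  r * one_cut_density a b h (r * y + u).
Proof.
move=> r0; rewrite /one_cut_density.
have -> : (a <= r * y + u <= b) = ((a - u) / r <= y <= (b - u) / r).
  by rewrite ler_pdivrMr// ler_pdivlMr// lerBlDr lerBrDr (mulrC y).
case: ifP => _; last by rewrite mulr0.
rewrite hornerZ horner_comp horner_affine.
have -> : (r * y + u - a) * (r * y + u - b) =
    r ^+ 2 * ((y - (a - u) / r) * (y - (b - u) / r)).
  by field; rewrite gt_eqF.
rewrite (normrM (r ^+ 2)) sqrtrM ?normr_ge0// (ger0_norm (sqr_ge0 r)).
by rewrite sqrtr_sqr (gtr0_norm r0); ring.
Qed.

(** Since ln |r (x - y)| = ln r + ln |x - y| off the diagonal and the mass is 1, the potential
    changes by the constant ln r. The constant l becomes l - 2 ln r + c; subtracting c from the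
    field serves to restore the value 0 at 0. *)
Lemma one_cut_data_affine V a b h (r u c : R) : 0 < r ->
  one_cut_data V a b h ->
  one_cut_data (V \Po affine r u - c%:P) ((a - u) / r) ((b - u) / r)
    (r ^+ 2 *: (h \Po affine r u)).
Proof.
move=> r0 [ab h0 m [l [lin lout]]].
have ab' : (a - u) / r < (b - u) / r by rewrite ltr_pM2r ?invr_gt0// ltrD2r.
have mem x : ((a - u) / r <= x <= (b - u) / r) = (a <= r * x + u <= b).
  by rewrite ler_pdivrMr// ler_pdivlMr// lerBlDr lerBrDr (mulrC x).
have h0' y : (a - u) / r <= y <= (b - u) / r ->
    0 < (r ^+ 2 *: (h \Po affine r u)).[y].
  rewrite mem => /h0 hy; rewrite hornerZ horner_comp horner_affine.
  by rewrite mulr_gt0// exprn_gt0.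
set h' := _ *: _ in h0' *; set a' := (a - u) / r in ab' h0' mem *.
set b' := (b - u) / r in ab' h0' mem *.
have wE y : one_cut_density a' b' h' y = r * one_cut_density a b h (r * y + u).
  exact: one_cut_density_affine.
have rn0 : r != 0 by rewrite gt_eqF.
have mE k a1 b1 : measurable_fun (setT : set (measurableTypeR R))
    (fun y => (one_cut_density a1 b1 k y)%:E).
  by apply/measurable_EFinP; exact: measurable_one_cut_density.
have m' : (\int[leb]_y (one_cut_density a' b' h' y)%:E = 1)%E.
  rewrite -[RHS]m [RHS](ge0_integral_affine u rn0 (mE h a b)); last first.
    by move=> y; rewrite lee_fin one_cut_density_ge0.
  rewrite -ge0_integralZl//; last 2 first.
  - exact: (measurableT_comp (mE h a b) (measurable_affine r u)).
  - by move=> y _; rewrite lee_fin one_cut_density_ge0.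
  by apply: eq_integral => y _; rewrite wE EFinM gtr0_norm.
have potA x : pot (one_cut_density a' b' h') x =
    pot (one_cut_density a b h) (r * x + u) - ln r.
  apply/eqP; rewrite eq_sym subr_eq; apply/eqP/EFin_inj.
  rewrite -(pot_one_cutE _ ab h0) EFinD -(pot_one_cutE _ ab' h0').
  have i0 := integrable_ln_one_cut (r * x + u) ab h0.
  have i1 := integrable_ln_one_cut x ab' h0'.
  have iw : leb.-integrable setT (fun y => (one_cut_density a' b' h' y)%:E).
    apply/integrableP; split; first exact: mE.
    under eq_integral do rewrite /= ger0_norm ?one_cut_density_ge0//.
    by rewrite m' ltry.
  rewrite -[X in (_ + X)%E]mule1 -m' -(integralZl measurableT iw).
  rewrite -(integralD measurableT i1 (integrableZl measurableT (ln r) iw)).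
  rewrite (integral_affine u rn0 i0).
  have i0' := integrable_affine u rn0 i0.
  rewrite -(integralZl measurableT i0').
  apply: (@eq_integral_except1 _ x).
  - exact: measurable_int (integrableZl measurableT `|r| i0').
  - exact: measurable_int (integrableD measurableT i1 (integrableZl measurableT (ln r) iw)).
  move=> y yx; rewrite -!EFinM -EFinD wE; congr EFin.
  have -> : r * x + u - (r * y + u) = r * (x - y) by ring.
  rewrite normrM (gtr0_norm r0) lnM ?posrE// ?normr_gt0 ?subr_eq0 1?eq_sym//.
  ring.
split=> //; exists (l - 2 * ln r + c); split=> x; rewrite potA mem => xab;
  rewrite hornerD hornerN hornerC horner_comp horner_affine.
  by rewrite -(lin _ xab); ring.
by have := lout _ xab; lra.
Qed.

End one_cut_data_operations.

(** * The semicircle law *)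

Section cosine_pushforward.
Context {R : realType}.
Local Notation leb := (@lebesgue_measure R).

(** On [0, pi] this is the density of an angle t for which cos t follows the semicircle law;
    [arc_density] is its extension by 0. *)
Definition sin2_density (t : R) : R := 2 / pi * sin t ^+ 2.

Definition arc_density (t : R) : R := if 0 <= t <= pi then sin2_density t else 0.

Definition semicircle : R -> R := one_cut_density (-1) 1 (2 / pi)%:P.

Lemma sin2_density_ge0 t : 0 <= sin2_density t.
Proof. by rewrite mulr_ge0 ?sqr_ge0// divr_ge0 ?pi_ge0. Qed.

Lemma arc_density_ge0 t : 0 <= arc_density t.
Proof. by rewrite /arc_density; case: ifP => // _; exact: sin2_density_ge0. Qed.

Lemma continuous_sin2_density : continuous sin2_density.
Proof.
move=> t; apply: cvgM; first exact: cvg_cst.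
by rewrite expr2; apply: cvgM; exact: continuous_sin.
Qed.

Lemma measurable_arc_density : measurable_fun setT arc_density.
Proof.
apply: measurable_fun_ifT => //.
  by apply: measurable_and; exact: measurable_fun_ler.
exact: continuous_measurable_fun continuous_sin2_density.
Qed.

Lemma semicircle_ge0 y : 0 <= semicircle y.
Proof.
apply: one_cut_density_ge0 => x _; rewrite hornerC divr_gt0//; exact: pi_gt0.
Qed.

Lemma measurable_semicircle : measurable_fun setT semicircle.
Proof. exact: measurable_one_cut_density. Qed.

Lemma integral_sin2_density (c : R) : 0 <= c ->
  (\int[leb]_(t in `[0%R, c]) (sin2_density t)%:E = (pi^-1 * (c - sin c * cos c))%:E)%E.
Proof.
move=> c0.
have -> : (pi^-1 * (c - sin c * cos c)) = pi^-1 * (c - sin c * cos c) -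
    pi^-1 * (0 - sin 0 * cos 0) :> R by rewrite sin0 mul0r subrr mulr0 subr0.
apply: (@integral_is_derive R _ (fun t => pi^-1 * (t - sin t * cos t))) => //.
  move=> t _; apply: is_derive_eq.
  rewrite /GRing.scale/= /sin2_density.
  by have := cos2Dsin2 t => h; rewrite -[X in X - _]h; ring.
by move=> t _; exact: continuous_sin2_density.
Qed.

Lemma derive1_cos : (@cos R)^`()%classic = (fun t => - sin t).
Proof. by apply/funext => t; rewrite derive1E; have [] := is_derive_cos t. Qed.

(** Under y = cos t, the square root and the Jacobian each contribute a factor sin t. *)
Lemma semicircle_substitution (c : R) : -1 <= c <= 1 ->
  (\int[leb]_(y in `[c, 1%R]) (semicircle y)%:E =
   \int[leb]_(t in `[0%R, acos c]) (sin2_density t)%:E)%E.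
Proof.
move=> c11; have ac0 := acos_ge0 c11; have acpi := acos_lepi c11.
have cac : cos (acos c) = c by rewrite acosK// in_itv.
have dcos t : derivable (@cos R) t 1 by exact: derivable_cos.
have ccos := @continuous_cos R.
have cdcos : continuous ((@cos R)^`()%classic).
  by rewrite derive1_cos => t; apply: continuousN; exact: continuous_sin.
have := @integration_by_substitution_decreasing R cos
  (fun y => Num.sqrt `|(y - -1) * (y - 1)| * (2 / pi)%:P.[y]) 0 (acos c) ac0.
rewrite cac cos0 => H.
transitivity (\int[leb]_(y in `[c, 1%R])
    (Num.sqrt `|(y - -1) * (y - 1)| * (2 / pi)%:P.[y])%:E)%E.
  apply: eq_integral => y; rewrite inE/= in_itv/= => /andP[cy y1].
  rewrite /semicircle /one_cut_density ifT//; case/andP: c11 => c1 _.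
  by rewrite (le_trans c1 cy) y1.
rewrite H.
- apply: eq_integral => t; rewrite inE/= in_itv/= => /andP[t0 tc].
  have s0 : 0 <= sin t by rewrite sin_ge0_pi// t0 (le_trans tc).
  rewrite derive1_cos; congr EFin.
  transitivity (Num.sqrt `|(cos t - -1) * (cos t - 1)| * (2 / pi)%:P.[cos t] * - - sin t).
    by [].
  rewrite hornerC.
  have -> : (cos t - -1) * (cos t - 1) = - (sin t ^+ 2).
    by rewrite sin2cos2; ring.
  rewrite normrN (ger0_norm (sqr_ge0 _)) sqrtr_sqr (ger0_norm s0) /sin2_density.
  by rewrite expr2; ring.
- move=> x y; rewrite !in_itv/= => /andP[x0 xc] /andP[y0 yc] xy.
  by rewrite ltr_cos ?in_itv/= ?x0 ?y0 ?(le_trans xc) ?(le_trans yc).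
- by move=> x _; exact: cdcos.
- by apply: cvgP; apply: cvg_at_right_filter; exact: cdcos.
- by apply: cvgP; apply: cvg_at_left_filter; exact: cdcos.
- split; first by move=> x _; exact: dcos.
    by apply: cvg_at_right_filter; exact: ccos.
  by apply: cvg_at_left_filter; exact: ccos.
- by apply: continuous_subspaceT; exact: continuous_sqrt_horner.
Qed.

Lemma integral_arc_density : (\int[leb]_t (arc_density t)%:E = 1)%E.
Proof.
have -> : (\int[leb]_t (arc_density t)%:E =
    \int[leb]_(t in `[0%R, pi]) (sin2_density t)%:E)%E.
  rewrite [RHS]integral_mkcond; apply: eq_integral => t _.
  by rewrite patchE mem_setE in_itv/= /arc_density; case: ifP.
rewrite integral_sin2_density ?pi_ge0// sinpi mul0r subr0 mulVf//.
by rewrite gt_eqF// pi_gt0.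
Qed.

Lemma integral_semicircle : (\int[leb]_y (semicircle y)%:E = 1)%E.
Proof.
have -> : (\int[leb]_y (semicircle y)%:E =
    \int[leb]_(y in `[(-1)%R, 1%R]) (semicircle y)%:E)%E.
  rewrite [RHS]integral_mkcond; apply: eq_integral => y _.
  rewrite patchE mem_setE in_itv/= /semicircle /one_cut_density.
  by case: ifP => //; case: ifP.
rewrite semicircle_substitution ?lexx/=; last by lra.
rewrite acosN1 -integral_arc_density [LHS]integral_mkcond.
apply: eq_integral => t _.
by rewrite patchE mem_setE in_itv/= /arc_density; case: ifP.
Qed.

(** Rays starting below -1 have full mass and those starting at 1 or above have none. In between,
    cos decreases on [0, pi], so the condition c < cos t cuts out [0, acos c[; the end point is
    null. *)
Lemma semicircle_ray (c : R) :
  (\int[leb]_(y in `]c, +oo[) (semicircle y)%:E =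
   \int[leb]_(t in [set t | (c < cos t)%R]) (arc_density t)%:E)%E.
Proof.
have mC : measurable_fun setT (@cos R).
  exact: continuous_measurable_fun (@continuous_cos R).
have mS : measurable_fun (setT : set (measurableTypeR R)) (fun y => (semicircle y)%:E).
  by apply/measurable_EFinP; exact: measurable_semicircle.
have mA : measurable_fun (setT : set (measurableTypeR R)) (fun y => (arc_density y)%:E).
  by apply/measurable_EFinP; exact: measurable_arc_density.
have mray : measurable ([set t | c < cos t] : set (measurableTypeR R)).
  rewrite (_ : [set t | c < cos t] = cos @^-1` `]c, +oo[%classic).
    by rewrite -[X in measurable X]setTI; apply: mC => //; exact: measurable_itv.
  by apply/seteqP; split=> t; rewrite /= in_itv/= andbT.
have [c1|c1] := ltP c (-1).
  transitivity (\int[leb]_y (semicircle y)%:E)%E.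
    rewrite integral_mkcond; apply: eq_integral => y _.
    rewrite patchE mem_setE in_itv/= andbT; case: ltP => // yc.
    rewrite /semicircle /one_cut_density ifF//; apply/negbTE/negP => /andP[]; lra.
  rewrite integral_semicircle -integral_arc_density [RHS]integral_mkcond.
  apply: eq_integral => t _; rewrite patchE mem_set//=.
  exact: lt_le_trans c1 (cos_geN1 t).
have [c2|c2] := leP 1 c.
  rewrite integral_mkcond [RHS]integral_mkcond; apply: eq_integral => y _.
  rewrite !patchE mem_setE in_itv/= andbT (memNset (A := [set t | c < cos t])); last first.
    by apply/negP; rewrite -leNgt (le_trans (cos_le1 y)).
  case: ltP => // cy.
  rewrite /semicircle /one_cut_density ifF//; apply/negbTE/negP => /andP[]; lra.
have c11 : -1 <= c <= 1 by rewrite c1 ltW.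
transitivity (\int[leb]_(y in `[c, 1%R]) (semicircle y)%:E)%E.
  rewrite integral_mkcond [RHS]integral_mkcond.
  apply: (@eq_integral_except1 _ c).
  - exact/(measurable_restrictT _ (measurable_itv _))/measurable_funTS.
  - exact/(measurable_restrictT _ (measurable_itv _))/measurable_funTS.
  move=> y yc; rewrite !patchE !mem_setE !in_itv/= andbT lt_neqAle eq_sym yc/=.
  case: (leP c y) => //= cy; case: (leP y 1) => // y1.
  rewrite /semicircle /one_cut_density ifF//; apply/negbTE/negP => /andP[]; lra.
rewrite semicircle_substitution//.
have ac0 := acos_ge0 c11; have acpi := acos_lepi c11.
rewrite integral_mkcond [RHS]integral_mkcond.
apply: (@eq_integral_except1 _ (acos c)).
- apply/(measurable_restrictT _ (measurable_itv _))/measurable_funTS/measurable_EFinP.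
  exact: continuous_measurable_fun continuous_sin2_density.
- exact/(measurable_restrictT _ mray)/measurable_funTS.
move=> t tc; rewrite !patchE mem_setE in_itv/= /arc_density.
have [t0|t0] := leP 0 t; last by rewrite /=; case: ifP.
have [tpi|tpi] := leP t pi; last first.
  rewrite /= (_ : t <= acos c = false)/=; first by case: ifP.
  by apply/negbTE; rewrite -ltNge (le_lt_trans acpi).
have -> : (t \in [set t | c < cos t]) = (t <= acos c).
  rewrite -{1}(@acosK R c) ?in_itv//.
  apply/idP/idP => [/set_mem/=|ta].
    by rewrite ltr_cos ?in_itv/= ?ac0 ?t0//; exact: ltW.
  apply/mem_set => /=; rewrite ltr_cos ?in_itv/= ?ac0 ?t0//.
  by rewrite lt_neqAle tc.
by case: ifP.
Qed.

(** The function g will have a logarithmic singularity, whereas the substitution rule was used on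
    continuous integrands. So the semicircle law is identified as a measure with the image of the
    arc law under cos: the two agree on the rays ]c, +oo[, which are stable under intersection and
    generate the Borel sets. *)
Lemma integral_semicircle_cos (g : R -> \bar R) : measurable_fun setT g ->
  (\int[leb]_y (g y * (semicircle y)%:E) =
   \int[leb]_t (g (cos t) * (arc_density t)%:E))%E.
Proof.
move=> mg.
have [P PE] := density_probability measurable_semicircle semicircle_ge0 integral_semicircle.
have [Q QE] := density_probability measurable_arc_density arc_density_ge0 integral_arc_density.
have mC : measurable_fun setT (@cos R : R -> R).
  exact: continuous_measurable_fun (@continuous_cos R).
pose Qc := pushforward_measure Q mC.
have PQ (A : set R) : measurable A -> P A = Qc A.
  apply: (measure_unique (@RGenOInfty.G R) (fun n => `](- n%:R), +oo[%classic)).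
  - exact: RGenOInfty.measurableE.
  - move=> _ _ [x ->] [y ->]; exists (Num.max x y).
    by apply/seteqP; split=> z /=; rewrite !in_itv/= !andbT gt_max => /andP.
  - by move=> n; exists (- n%:R).
  - apply/seteqP; split=> // x _.
    exists (Num.truncn `|x|).+1 => //=; rewrite in_itv/= andbT ltrNl.
    by apply: le_lt_trans (truncnS_gt _); rewrite -normrN ler_norm.
  - move=> _ [x ->]; rewrite /Qc/= /pushforward PE ?QE; last 2 first.
    + rewrite -[X in measurable X]setTI.
      exact: (mC measurableT _ (measurable_itv `]x, +oo[)).
    + exact: measurable_itv.
    rewrite semicircle_ray; congr (integral _ _ _).
    by apply/seteqP; split=> t /=; rewrite in_itv/= andbT.
  - move=> n; apply: (@le_lt_trans _ _ 1%E); last exact: ltry.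
    by apply: probability_le1; exact: measurable_itv.
rewrite -(integral_lebesgue_density measurable_semicircle semicircle_ge0 PE mg).
have mgc : measurable_fun setT (g \o (@cos R)) by exact: measurableT_comp.
rewrite -(integral_lebesgue_density measurable_arc_density arc_density_ge0 QE mgc).
transitivity (\int[Qc]_x g x)%E.
  by apply: eq_measure_integral => A mA _; exact: PQ.
exact: measurable_integral_pushforward.
Qed.

End cosine_pushforward.

Lemma is_derive_continuous (R : realType) (f : R -> R) (x d : R) :
  is_derive x 1 f d -> {for x, continuous f}.
Proof.
by move=> [df _]; apply: differentiable_continuous; exact/derivable1_diffP.
Qed.

(** * The function ln |2 sin (t / 2)|: integrability and tools for its primitives *)

Section log_sine.
Context {R : realType}.
Local Notation leb := (@lebesgue_measure R).
Implicit Types (t x : R).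

Definition lnsin t : R := ln `|2 * sin (t / 2)|.

(** Half-open, so that the translates of a period tile the line without overlap. *)
Definition window (k : R -> R) t : R := if - pi < t <= pi then lnsin t * k t else 0.

Lemma lnsinN t : lnsin (- t) = lnsin t.
Proof. by rewrite /lnsin mulNr sinN mulrN normrN. Qed.

Lemma lnsin_period t : lnsin (t - 2 * pi) = lnsin t.
Proof.
rewrite /lnsin; have -> : (t - 2 * pi) / 2 = t / 2 - pi by field.
by rewrite -normrN -mulrN -sinDpi subrK.
Qed.

(** On [0, 1] the mean value theorem gives sin s >= s cos 1. On [1, pi / 2], sin t >= sin 1 >= cos
    1, and halving the slope suffices because t < 2. *)
Lemma sin_ge_linear t : 0 <= t <= pi / 2 -> cos 1 / 2 * t <= sin t.
Proof.
move=> /andP[t0 tp]; have c1 := @cos1_gt0 R.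
have p2 := @pihalf_lt2 R; have p1 := @pihalf_ge1 R.
have small (s : R) : 0 <= s <= 1 -> cos 1 * s <= sin s.
  move=> /andP[s0 s1]; have [->|sn0] := eqVneq s 0; first by rewrite mulr0 sin0.
  have sp : 0 < s by rewrite lt_neqAle eq_sym sn0.
  have [z] := @MVT R sin cos 0 s sp (fun x _ => is_derive_sin x)
    (continuous_subspaceT (@continuous_sin R)).
  rewrite in_itv/= sin0 !subr0 => /andP[z0 zs] ->.
  apply: ler_wpM2r => //; apply: ltW; rewrite ltr_cos ?in_itv/=; [lra|lra|].
  by have := @pi_ge2 R; move=> ?; apply/andP; split; lra.
have [t1|t1] := leP t 1.
  apply: le_trans (small t _); last by rewrite t0.
  by apply: ler_wpM2r => //; lra.
apply: (@le_trans _ _ (cos 1)).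
  by rewrite -mulrA ger_pMr//; lra.
apply: (@le_trans _ _ (sin 1)).
  by have := small 1; rewrite mulr1; apply; rewrite ler01 lexx.
apply: ltW; rewrite ltr_sin ?in_itv/=; [by []|apply/andP; split; lra|apply/andP; split; lra].
Qed.

(** For 0 < t <= pi, 2 sin (t / 2) lies between (cos 1 / 2) t and 2. Negative t follow by parity. *)
Lemma norm_lnsin_le t : - pi < t <= pi ->
  `|lnsin t| <= `|ln `|t| | + (ln 2 + `|ln (cos 1 / 2)|).
Proof.
wlog t0 : t / 0 <= t => [H tpi|/andP[tp1 tp2]].
  have [/H|t0] := leP 0 t; first exact.
  have := H (- t); rewrite lnsinN normrN; apply; first by rewrite oppr_ge0 ltW.
  by case/andP: tpi => ? ?; apply/andP; split; lra.
have [->|tn0] := eqVneq t 0.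
  rewrite /lnsin mul0r sin0 mulr0 normr0 ln0// normr0 add0r addr_ge0// ln_ge0//; lra.
have tp : 0 < t by rewrite lt_neqAle eq_sym tn0.
have c1 : 0 < cos 1 / 2 :> R by rewrite divr_gt0// cos1_gt0.
have low : cos 1 / 2 * t <= 2 * sin (t / 2).
  have /sin_ge_linear : 0 <= t / 2 <= pi / 2 by apply/andP; split; lra.
  by lra.
have sp : 0 < 2 * sin (t / 2) by apply: lt_le_trans low; rewrite mulr_gt0.
rewrite /lnsin (gtr0_norm sp) (gtr0_norm tp) ler_norml; apply/andP; split.
  have : ln (cos 1 / 2 * t) <= ln (2 * sin (t / 2)).
    by rewrite ler_ln ?posrE// mulr_gt0.
  rewrite lnM ?posrE//.
  have := ler_norm (- ln (cos 1 / 2) : R); have := ler_norm (- ln t); rewrite !normrN.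
  have : 0 <= ln 2 :> R by rewrite ln_ge0//; lra.
  lra.
have : ln (2 * sin (t / 2)) <= ln 2.
  by rewrite ler_ln ?posrE// ger_pMr// sin_le1.
have := normr_ge0 (ln t); have := normr_ge0 (ln (cos 1 / 2) : R); lra.
Qed.

Lemma measurable_lnsin : measurable_fun setT lnsin.
Proof.
apply: measurableT_comp; first exact: measurable_ln.
apply: measurableT_comp => //; apply: measurable_funM => //.
apply: measurableT_comp; first exact: continuous_measurable_fun (@continuous_sin R).
by apply: measurable_funM.
Qed.

Lemma measurable_in_period : measurable_fun setT (fun t : R => - pi < t <= pi).
Proof. by apply: measurable_and; [exact: measurable_fun_ltr|exact: measurable_fun_ler]. Qed.

Lemma measurable_window k : measurable_fun setT k -> measurable_fun setT (window k).
Proof.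
move=> mk; apply: measurable_fun_ifT => //; first exact: measurable_in_period.
by apply: measurable_funM => //; exact: measurable_lnsin.
Qed.

(** [lnsin] is compared with ln |t|, whose integrability over a period is the case x = 0 of
    [integrable_ln_density] for the indicator w of that period. *)
Lemma integrable_window (k : R -> R) (B : R) : measurable_fun setT k ->
  (forall t, `|k t| <= B) -> leb.-integrable setT (fun t => (window k t)%:E).
Proof.
move=> mk kB.
have B0 : 0 <= B by apply: le_trans (kB 0).
pose w t : R := if - pi < t <= pi then 1 else 0.
have mw : measurable_fun setT w.
  by apply: measurable_fun_ifT => //; exact: measurable_in_period.
have w0 t : 0 <= w t by rewrite /w; case: ifP.
have w1 t : w t <= 1 by rewrite /w; case: ifP.
have ws t : pi < `|t| -> w t = 0.
  rewrite /w => tp; case: ifP => // /andP[t1 t2]; exfalso.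
  by move: tp; case: (ger0P t) => _; lra.
have i1 := integrable_ln_density mw w0 w1 ws 0.
have i2 : leb.-integrable setT (fun t => (w t)%:E).
  apply: (le_integrable measurableT _ _ (integrable_indic_itv (- pi) pi true false)).
    exact/measurable_EFinP.
  move=> t _ /=; rewrite lee_fin indicE mem_setE in_itv/= /w.
  case: ifP => [/andP[t1 t2]|]; last by rewrite normr0.
  by rewrite (ltW t1) t2.
pose K : R := ln 2 + `|ln (cos 1 / 2)|.
have i3 := integrableD measurableT (integrableZl measurableT B (integrable_abse i1))
  (integrableZl measurableT (B * K) i2).
apply: (le_integrable measurableT _ _ i3).
  by apply/measurable_EFinP; exact: measurable_window.
move=> t _ /=; rewrite lee_fin sub0r normrN /window /w.
case: ifP => tp; last by rewrite !mulr0 normr0 mulr0 addr0 normr0.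
rewrite !mulr1 normrM mulrC; apply: (@le_trans _ _ (B * (`|ln `|t| | + K))).
  by apply: ler_pM => //; exact: norm_lnsin_le.
by rewrite mulrDr ler_norm.
Qed.

(** This is ln v <= v at v = 1 / sqrt s, because ln s = 2 ln (sqrt s). *)
Lemma xlnx_ge (s : R) : 0 < s <= 1 -> - (2 * Num.sqrt s) <= s * ln s.
Proof.
move=> /andP[s0 s1]; have q0 : 0 < Num.sqrt s by rewrite sqrtr_gt0.
have := ltW (@ln_sublinear R (Num.sqrt s)^-1 _); rewrite invr_gt0 => /(_ q0).
rewrite lnV ?posrE// => h.
have lE : ln s = 2 * ln (Num.sqrt s).
  by rewrite -[in LHS](sqr_sqrtr (ltW s0)) lnXn// mulr_natl.
have : s * (- ln (Num.sqrt s)) <= s * (Num.sqrt s)^-1 by rewrite ler_pM2l.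
rewrite -[X in _ <= X * _](sqr_sqrtr (ltW s0)) expr2 mulfK ?gt_eqF// lE => h2.
by lra.
Qed.

Lemma cvg_xlnx (T : Type) (A : set_system T) (FA : Filter A) (s : T -> R) :
  (\near A, 0 < s A) -> s @ A --> (0 : R) -> (fun t : T => s t * ln (s t)) @ A --> (0 : R).
Proof.
move=> sp s0.
have s1 : \near A, s A <= 1 by apply: cvgr_le s0 _ _; exact: ltr01.
apply: (@squeeze_cvgr _ _ _ _ (fun t : T => - (2 * Num.sqrt (s t))) (fun=> 0)).
- near=> t.
  have tp : 0 < s t by near: t.
  have t1 : s t <= 1 by near: t.
  rewrite xlnx_ge ?tp//=; apply: mulr_ge0_le0; first exact: ltW.
  exact: ln_le0.
- rewrite -[X in _ --> X]oppr0; apply: cvgN.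
  rewrite -[X in _ --> X](mulr0 2); apply: cvgM; first exact: cvg_cst.
  rewrite -[X in _ --> X](@sqrtr0 R).
  exact: (@cvg_comp _ _ _ s Num.sqrt A _ _ s0 (@sqrt_continuous R 0)).
- exact: cvg_cst.
Unshelve. all: by end_near. Qed.

(** Covers an integrable f singular at 0. The integral G of f over [0, x] tends to 0 with x, while
    the ordinary theorem on [x, b] shows that it tends to the full integral minus F b - F 0. *)
Lemma improper_FTC2 (f F : R -> R) (b : R) : 0 < b ->
  leb.-integrable `[0, b] (EFin \o f) ->
  (forall x, 0 < x <= b -> is_derive x 1 F (f x)) ->
  (forall x, 0 < x <= b -> {for x, continuous f}) ->
  F x @[x --> 0^'+] --> F 0 ->
  (\int[leb]_(x in `[0%R, b]) (f x)%:E = (F b - F 0)%:E)%E.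
Proof.
move=> b0 fi dF cf F0.
have finE : (\int[leb]_(x in `[0%R, b]) (f x)%:E = (\int[leb]_(x in `[0, b]) f x)%:E)%E.
  by rewrite /Rintegral fineK//; exact: integrable_fin_num fi.
rewrite finE; congr EFin; set I := Rintegral _ _ _.
pose G x := \int[leb]_(t in `[0, x]) f t.
have GE x : 0 < x < b -> G x = I - (F b - F x).
  move=> /andP[x0 xb].
  have := @Rintegral_itvB R f (BLeft 0) (BRight b) x fi.
  rewrite !bnd_simp (ltW x0) (ltW xb) => /(_ isT isT); rewrite -/I -/(G x).
  have -> : \int[leb]_(y in `]x, b]) f y = F b - F x.
    rewrite Rintegral_itv_obnd_cbnd; last first.
      apply: integrableS fi => //.
      by move=> y /=; rewrite !in_itv/= => /andP[xy ->]; rewrite ltW// (lt_trans x0).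
    have E : (\int[leb]_(y in `[x, b]) (f y)%:E = (F b - F x)%:E)%E.
      apply: (@integral_is_derive R f F); first exact: ltW.
        by move=> y /andP[xy yb]; apply: dF; rewrite (lt_le_trans x0).
      by move=> y /andP[xy yb]; apply: cf; rewrite (lt_le_trans x0).
    by rewrite /Rintegral E.
  by move=> <-; rewrite opprB addrC subrK.
have [_ G0 _] := (continuous_within_itvP (fun x => G x) b0).1
  (parameterized_integral_continuous (ltW b0) fi).
have G00 : G 0 = 0 by rewrite /G set_itv1 Rintegral_set1.
have G1 : G x @[x --> 0^'+] --> I - (F b - F 0).
  apply: (@cvg_trans _ ((fun x => I - (F b - F x)) @ 0^'+)); last first.
    by apply: cvgB; [exact: cvg_cst|apply: cvgB => //; exact: cvg_cst].
  apply: near_eq_cvg; near=> x; rewrite GE//; apply/andP; split.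
    by near: x; exact: nbhs_right_gt.
  by near: x; exact: nbhs_right_lt.
have : G 0 = I - (F b - F 0) by apply: cvg_unique G0 G1.
by rewrite G00 => /eqP; rewrite eq_sym subr_eq0 => /eqP.
Unshelve. all: by end_near. Qed.

End log_sine.

(** * Fourier coefficients of ln |2 sin (t / 2)| *)

Section log_sine_integrals.
Context {R : realType}.
Local Notation leb := (@lebesgue_measure R).
Implicit Types (t x : R) (k : R -> R).

Definition bounded_measurable k :=
  measurable_fun setT k /\ exists B : R, forall t, `|k t| <= B.

Definition wint k : R := \int[leb]_t window k t.

Lemma integrable_wint k : bounded_measurable k ->
  leb.-integrable setT (fun t => (window k t)%:E).
Proof. by move=> [mk [B kB]]; exact: integrable_window mk kB. Qed.

Lemma wintE k : bounded_measurable k -> (\int[leb]_t (window k t)%:E = (wint k)%:E)%E.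
Proof.
by move=> /integrable_wint i; rewrite /wint /Rintegral fineK//; exact: integrable_fin_num i.
Qed.

Lemma bounded_measurableD k1 k2 : bounded_measurable k1 -> bounded_measurable k2 ->
  bounded_measurable (fun t => k1 t + k2 t).
Proof.
move=> [m1 [B1 b1]] [m2 [B2 b2]]; split; first exact: measurable_funD.
by exists (B1 + B2) => t; apply: le_trans (ler_normD _ _) _; exact: lerD.
Qed.

Lemma bounded_measurableZ a k : bounded_measurable k ->
  bounded_measurable (fun t => a * k t).
Proof.
move=> [m1 [B1 b1]]; split; first exact: measurable_funM.
by exists (`|a| * B1) => t; rewrite normrM ler_wpM2l.
Qed.

Lemma wintD k1 k2 : bounded_measurable k1 -> bounded_measurable k2 ->
  wint (fun t => k1 t + k2 t) = wint k1 + wint k2.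
Proof.
move=> b1 b2; apply: EFin_inj; rewrite EFinD -!wintE//; last exact: bounded_measurableD.
rewrite -(integralD measurableT (integrable_wint b1) (integrable_wint b2)).
apply: eq_integral => t _; rewrite -EFinD /window; congr EFin.
by case: ifP => _; rewrite ?addr0// mulrDr.
Qed.

Lemma wintZ a k : bounded_measurable k -> wint (fun t => a * k t) = a * wint k.
Proof.
move=> b1; apply: EFin_inj; rewrite EFinM -!wintE//; last exact: bounded_measurableZ.
rewrite -(integralZl measurableT (integrable_wint b1)).
apply: eq_integral => t _; rewrite -EFinM /window; congr EFin.
by case: ifP => _; rewrite ?mulr0// mulrCA.
Qed.

Lemma eq_wint k1 k2 : (forall t, - pi < t <= pi -> k1 t = k2 t) -> wint k1 = wint k2.
Proof.
move=> k12; apply: eq_Rintegral => t _; rewrite /window; case: ifP => // tp.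
by rewrite k12.
Qed.

Lemma bounded_measurable_cst (a : R) : bounded_measurable (fun=> a).
Proof. by split; [exact: measurable_cst|exists `|a|]. Qed.

Lemma bounded_measurable_cos2 : bounded_measurable (fun t => cos (2 * t)).
Proof.
split; last by exists 1 => t; exact: cos_max.
apply: measurableT_comp; first exact: continuous_measurable_fun (@continuous_cos R).
by apply: measurable_funM.
Qed.

Lemma bounded_measurable_sin2 : bounded_measurable (fun t => sin (2 * t)).
Proof.
split; last by exists 1 => t; exact: sin_max.
apply: measurableT_comp; first exact: continuous_measurable_fun (@continuous_sin R).
by apply: measurable_funM.
Qed.

Lemma sin_double t : sin (2 * t) = 2 * sin t * cos t.
Proof. by rewrite mulr_natl sin_mulr2n -mulr_natl; ring. Qed.

Lemma cos_double t : cos (2 * t) = 2 * cos t ^+ 2 - 1.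
Proof. by rewrite mulr_natl cos_mulr2n -mulr_natl. Qed.

Lemma wint_sin2 : wint (fun t => sin (2 * t)) = 0.
Proof.
have i := integrable_wint bounded_measurable_sin2.
have n1 : (-1 : R) != 0 by rewrite oppr_eq0 oner_eq0.
have := integral_affine 0 n1 i; rewrite normrN1 mul1e wintE; last first.
  exact: bounded_measurable_sin2.
suff -> : (\int[leb]_y (window (fun t => sin (2 * t)) (-1 * y + 0)%R)%:E =
    (-1)%:E * \int[leb]_t (window (fun t => sin (2 * t)) t)%:E)%E.
  rewrite wintE; last exact: bounded_measurable_sin2.
  by rewrite -EFinM => h; have := EFin_inj h; lra.
rewrite -(integralZl measurableT i); apply: eq_integral => t _.
rewrite -EFinM mulN1r addr0 /window; congr EFin.
have s2pi : sin (2 * pi) = 0 :> R by rewrite mulr_natl sin2pi.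
rewrite lnsinN mulrN sinN.
(* Reflection does not preserve the half-open period, but sin (2 t) vanishes at both ends, where
   alone it fails. *)
have [->|tp] := eqVneq t pi; first by rewrite s2pi oppr0 !mulr0 !if_same mulr0.
have [->|tm] := eqVneq t (- pi).
  have s2m : sin (2 * - pi) = 0 :> R by rewrite mulrN sinN s2pi oppr0.
  by rewrite s2m oppr0 !mulr0 !if_same mulr0.
have -> : (- pi < - t <= pi) = (- pi < t <= pi).
  rewrite ltrN2 lerNl andbC; congr andb.
    by rewrite le_eqVlt eq_sym (negbTE tm).
  by rewrite [in RHS]le_eqVlt (negbTE tp).
by case: ifP => _; rewrite ?mulr0// mulrN mulN1r.
Qed.

Let fl t : R := ln (2 * sin (t / 2)) * cos (2 * t).
(** A primitive of [fl] found by parts: the subtracted term integrates one quarter of sin (2 t) cot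
    (t / 2) = 1 + 2 cos t + cos (2 t). *)
Let FL t : R := sin (2 * t) / 2 * ln (2 * sin (t / 2)) - (sin t + t / 2 + sin (2 * t) / 4) / 2.

Let half_gt0 t : 0 < t <= pi -> 0 < 2 * sin (t / 2).
Proof.
move=> /andP[t0 tpi]; rewrite mulr_gt0// sin_gt0_pi//.
by have := @pi_gt0 R; move=> ?; apply/andP; split; lra.
Qed.

Let d_half t : is_derive t 1 (fun t => 2 * sin (t / 2)) (cos (t / 2)).
Proof.
have dg : is_derive t 1 (fun t : R => t / 2) (1 / 2).
  by apply: is_derive_eq; rewrite /GRing.scale/=; field.
have ds : is_derive t 1 (fun t : R => sin (t / 2)) (cos (t / 2) * (1 / 2)).
  exact: (@is_derive1_comp R (@sin R) (fun t => t / 2) t _ _ (is_derive_sin (t / 2)) dg).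
by apply: is_derive_eq; rewrite /GRing.scale/=; field.
Qed.

Let d_ln t : 0 < t <= pi ->
  is_derive t 1 (fun t => ln (2 * sin (t / 2))) ((2 * sin (t / 2))^-1 * cos (t / 2)).
Proof.
move=> tp.
exact: (@is_derive1_comp R (@ln R) (fun t => 2 * sin (t / 2)) t _ _
  (is_derive1_ln (half_gt0 tp)) (d_half t)).
Qed.

Let d_double t : is_derive t 1 (fun t : R => 2 * t) 2.
Proof. by apply: is_derive_eq; rewrite /GRing.scale/= mulr1. Qed.

Let d_FL t : 0 < t <= pi -> is_derive t 1 FL (fl t).
Proof.
move=> tp; have s0 := half_gt0 tp; have dl := d_ln tp.
have ds2 : is_derive t 1 (fun t : R => sin (2 * t)) (cos (2 * t) * 2).
  exact: (is_derive1_comp (is_derive_sin (2 * t)) (d_double t)).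
apply: is_derive_eq; rewrite /GRing.scale/= /fl.
have tE : t = 2 * (t / 2) by field.
have ct : cos t = 2 * cos (t / 2) ^+ 2 - 1 by rewrite [in LHS]tE cos_double.
have st : sin t = 2 * sin (t / 2) * cos (t / 2) by rewrite [in LHS]tE sin_double.
have -> : sin (2 * t) = 2 * sin t * cos t by exact: sin_double.
have -> : cos (2 * t) = 2 * cos t ^+ 2 - 1 by exact: cos_double.
rewrite st ct.
have sn0 : sin (t / 2) != 0 by move: s0; rewrite pmulr_rgt0// => /gt_eqF ->.
by field.
Qed.

Let FL0 : FL t @[t --> 0^'+] --> FL 0.
Proof.
have s0 : (fun t : R => 2 * sin (t / 2)) @ 0^'+ --> (0 : R).
  have e0 : 2 * sin (0 / 2) = 0 :> R by rewrite mul0r sin0 mulr0.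
  rewrite -[X in _ --> X]e0.
  apply: (@cvg_at_right_filter _ _ (fun t : R => 2 * sin (t / 2))).
  exact: (is_derive_continuous (d_half 0)).
have xl : (fun t : R => 2 * sin (t / 2) * ln (2 * sin (t / 2))) @ 0^'+ --> (0 : R).
  apply: cvg_xlnx s0; near=> t; apply: half_gt0; apply/andP; split.
    by near: t; exact: nbhs_right_gt.
  by near: t; apply: nbhs_right_le; exact: pi_gt0.
(* Since sin (2 t) = 4 sin (t / 2) cos (t / 2) cos t, the singular term of [FL] is g times s ln s
   with s = 2 sin (t / 2), which tends to 0. *)
pose g (t : R) := cos (t / 2) * cos t.
pose q (t : R) := (sin t + t / 2 + sin (2 * t) / 4) / 2.
have FE t : FL t = g t * (2 * sin (t / 2) * ln (2 * sin (t / 2))) - q t.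
  rewrite /FL /g -/(q t); congr (_ - _).
  have tE : t = 2 * (t / 2) by field.
  rewrite sin_double [sin t](_ : _ = 2 * sin (t / 2) * cos (t / 2)).
    by field.
  by rewrite [in LHS]tE sin_double.
have cs := @continuous_sin R; have cc := @continuous_cos R.
have cg : g t @[t --> 0^'+] --> g 0.
  apply: cvg_at_right_filter; apply: cvgM; last exact: cc.
  apply: (@cvg_comp _ _ _ (fun t : R => t / 2) cos); last exact: cc.
  by apply: cvgM; [exact: cvg_id|exact: cvg_cst].
have cq : q t @[t --> 0^'+] --> q 0.
  apply: cvg_at_right_filter; apply: cvgM; last exact: cvg_cst.
  apply: cvgD.
    by apply: cvgD; [exact: cs|apply: cvgM; [exact: cvg_id|exact: cvg_cst]].
  apply: cvgM; last exact: cvg_cst.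
  apply: (@cvg_comp _ _ _ (fun t : R => 2 * t) sin); last exact: cs.
  by apply: cvgM; [exact: cvg_cst|exact: cvg_id].
have -> : FL 0 = g 0 * 0 - q 0.
  by rewrite FE mul0r sin0 mulr0 mul0r.
have -> : FL = (fun t => g t * (2 * sin (t / 2) * ln (2 * sin (t / 2))) - q t).
  by apply/funext.
by apply: cvgB => //; exact: cvgM.
Unshelve. all: by end_near. Qed.

Let lnsin_pos t : 0 <= t <= pi -> lnsin t = ln (2 * sin (t / 2)).
Proof.
move=> /andP[t0 tpi]; rewrite /lnsin ger0_norm// mulr_ge0// sin_ge0_pi//.
by apply/andP; split; lra.
Qed.

Let fl_integrable : leb.-integrable `[0, pi] (EFin \o fl).
Proof.
have i := @integrableS _ (measurableTypeR R) R leb setT `[0, pi]%classic _ measurableT (measurable_itv _) (@subsetT _ _)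
  (integrable_wint bounded_measurable_cos2).
apply: eq_integrable i => // t; rewrite inE/= in_itv/= => tp.
have := @pi_gt0 R => p0.
rewrite /window ifT ?lnsin_pos//; case/andP: tp => ? ?; apply/andP; split; lra.
Qed.

Let fl_integral : (\int[leb]_(t in `[0%R, pi]) (fl t)%:E = (- (pi / 4))%:E)%E.
Proof.
rewrite (improper_FTC2 (pi_gt0 R) fl_integrable d_FL _ FL0).
  have s2pi : sin (2 * pi) = 0 :> R by rewrite mulr_natl sin2pi.
  by congr EFin; rewrite /FL s2pi mulr0 sin0 sinpi; field.
move=> t tp; apply: continuousM.
  exact: (is_derive_continuous (d_ln tp)).
apply: (@cvg_comp _ _ _ (fun t : R => 2 * t) cos); last exact: continuous_cos.
by apply: cvgM; [exact: cvg_cst|exact: cvg_id].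
Qed.

Lemma wint_cos2 : wint (fun t => cos (2 * t)) = - (pi / 2).
Proof.
pose g t := if 0 <= t <= pi then fl t else 0.
have gI : (\int[leb]_t (g t)%:E = (- (pi / 4))%:E)%E.
  rewrite -fl_integral [RHS]integral_mkcond; apply: eq_integral => t _.
  by rewrite patchE mem_setE in_itv/= /g; case: ifP.
have gi : leb.-integrable setT (fun t => (g t)%:E).
  have := fl_integrable; rewrite integrable_mkcond//.
  apply: eq_integrable => // t _.
  by rewrite patchE mem_setE in_itv/= /g; case: ifP.
have n1 : (-1 : R) != 0 by rewrite oppr_eq0 oner_eq0.
have gi' := integrable_affine 0 n1 gi.
have gI' : (\int[leb]_t (g (-1 * t + 0)%R)%:E = (- (pi / 4))%:E)%E.
  by rewrite -gI (integral_affine 0 n1 gi) normrN1 mul1e.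
apply: EFin_inj; rewrite -wintE; last exact: bounded_measurable_cos2.
have -> : (- (pi / 2))%:E = ((- (pi / 4))%:E + (- (pi / 4))%:E)%E :> \bar R.
  by rewrite -EFinD; congr EFin; field.
rewrite -{1}gI -gI'.
rewrite -(integralD measurableT gi gi').
(* The two halves are [0, pi] and its reflection. The reflection contains - pi, which the period
   omits; 0 lies in both halves, where [lnsin] is 0 by the convention ln 0 = 0. *)
apply: (@eq_integral_except1 _ (- pi)).
- exact: measurable_int (integrable_wint bounded_measurable_cos2).
- exact: measurable_int (integrableD measurableT gi gi').
move=> t tm; rewrite -EFinD mulN1r addr0; congr EFin; rewrite /window /g /fl.
have p0 := @pi_gt0 R.
have [t0|t0|->] := ltgtP t 0.
- rewrite /= add0r (_ : (0 <= - t <= pi) = (- pi < t <= pi)); last first.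
    rewrite oppr_ge0 (ltW t0) lerNl le_eqVlt eq_sym (negbTE tm)/=.
    by rewrite (_ : t <= pi) ?andbT//; lra.
  case: ifP => // /andP[t1 t2].
  rewrite -[in LHS]lnsinN lnsin_pos; last by apply/andP; split; lra.
  by rewrite mulrN cosN.
- rewrite (_ : (0 <= - t <= pi) = false); last by apply/negbTE/negP => /andP[]; lra.
  rewrite addr0 (_ : - pi < t)/=; last by lra.
  by case: ifP => // tp; rewrite lnsin_pos// (ltW t0) tp.
- rewrite oppr0 /lnsin mul0r sin0 mulr0 normr0 ln0// !mul0r.
  by rewrite !if_same addr0.
Qed.

End log_sine_integrals.

(** * The potential of the semicircle law inside and outside [-1, 1] *)

Section semicircle_data.
Context {R : realType}.
Local Notation leb := (@lebesgue_measure R).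
Implicit Types (t x : R).

Let hsc : {poly R} := (2 / pi)%:P.

Let hsc_gt0 y : -1 <= y <= 1 -> 0 < hsc.[y].
Proof. by move=> _; rewrite hornerC divr_gt0// pi_gt0. Qed.

Let lt11 : (-1 : R) < 1. Proof. by lra. Qed.

Lemma pot_semicircle_cos x : ((pot semicircle x)%:E =
  \int[leb]_t (ln `|x - cos t| * arc_density t)%:E)%E.
Proof.
rewrite -(pot_one_cutE x lt11 hsc_gt0).
have mg : measurable_fun setT (fun y : R => (ln `|x - y|)%:E).
  by apply/measurable_EFinP; exact: measurable_ln_norm_sub.
have := integral_semicircle_cos mg.
by under eq_integral do rewrite -EFinM; under [RHS]eq_integral do rewrite -EFinM.
Qed.

Lemma sin2_densityN t : sin2_density (- t) = sin2_density t.
Proof. by rewrite /sin2_density sinN sqrrN. Qed.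

Lemma sin2_density_period t : sin2_density (2 * pi - t) = sin2_density t.
Proof.
rewrite /sin2_density; have -> : 2 * pi - t = - (t - pi *+ 2) by rewrite -mulr_natl; ring.
rewrite sinN sqrrN; congr (_ * _ ^+ 2).
by rewrite -[in RHS](subrK (pi *+ 2) t) sinD2pi.
Qed.

Lemma sin2_density0 : sin2_density 0 = 0 :> R.
Proof. by rewrite /sin2_density sin0 expr0n mulr0. Qed.

Lemma sin2_density_pi : sin2_density pi = 0 :> R.
Proof. by rewrite /sin2_density sinpi expr0n mulr0. Qed.

Lemma sin2_density_le t : sin2_density t <= 2 / pi.
Proof.
by rewrite /sin2_density ger_pMr ?divr_gt0 ?pi_gt0// sin2cos2 gerBl sqr_ge0.
Qed.

(** Only the frequencies 0 and 2 occur, so these are the only Fourier coefficients of [lnsin] that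
    enter. *)
Lemma sin2_density_sub (p t : R) : sin2_density (p - t) =
  pi^-1 + (- (pi^-1 * cos (2 * p)) * cos (2 * t) + - (pi^-1 * sin (2 * p)) * sin (2 * t)).
Proof.
have -> : sin2_density (p - t) = pi^-1 * (1 - cos (2 * (p - t))).
  by rewrite /sin2_density cos_double cos2sin2; ring.
have -> : 2 * (p - t) = 2 * p - 2 * t by ring.
by rewrite cosB; ring.
Qed.

Lemma ln_cos_sub (p t : R) : sin ((p - t) / 2) != 0 -> sin ((p + t) / 2) != 0 ->
  ln `|cos p - cos t| = lnsin (p - t) + lnsin (p + t) - ln 2.
Proof.
move=> s1 s2.
have -> : cos p - cos t = - (2 * sin ((p - t) / 2) * sin ((p + t) / 2)).
  have E (u v : R) : cos (u + v) - cos (u - v) = - (2 * sin v * sin u).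
    by rewrite cosD cosB; ring.
  by rewrite -E; congr (cos _ - cos _); field.
have two0 : `|2 : R| = 2 by rewrite ger0_norm.
rewrite normrN !normrM /lnsin !normrM two0.
rewrite !lnM ?posrE ?mulr_gt0 ?normr_gt0//; ring.
Qed.

Section inside.
Variable p : R.
Hypothesis p0pi : 0 <= p <= pi.

(** As t runs over [0, pi], p - t runs over [I1], while p + t runs over [p, p + pi], whose part
    beyond pi is brought back by a period: this gives [I2] and [I3]. Within ]- pi, pi] the three
    pieces are disjoint and cover, so the two logarithms add up to one integral over a full period
    against sin^2 (p - t). *)
Let K (I : R -> bool) t : R := if I t then sin2_density (p - t) else 0.
Let I1 t := p - pi <= t <= p.
Let I2 t := p < t <= pi.
Let I3 t := (- pi < t) && (t < p - pi).

Let bm I : measurable_fun setT I -> bounded_measurable (K I).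
Proof.
move=> mI; split.
  apply: measurable_fun_ifT => //.
  apply: measurableT_comp; first exact: continuous_measurable_fun continuous_sin2_density.
  exact: measurable_funB.
exists (2 / pi) => t; rewrite /K; case: ifP => _; last first.
  by rewrite normr0 divr_ge0// pi_ge0.
by rewrite ger0_norm ?sin2_density_le// sin2_density_ge0.
Qed.

Let bm1 : bounded_measurable (K I1).
Proof. by apply: bm; apply: measurable_and; exact: measurable_fun_ler. Qed.

Let bm2 : bounded_measurable (K I2).
Proof. by apply: bm; apply: measurable_and; [exact: measurable_fun_ltr|exact: measurable_fun_ler]. Qed.

Let bm3 : bounded_measurable (K I3).
Proof. by apply: bm; apply: measurable_and; exact: measurable_fun_ltr. Qed.

Lemma sin_half_neq0 t : - pi <= t <= pi -> t != 0 -> sin (t / 2) != 0.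
Proof.
wlog t0 : t / 0 < t => [H tpi tn0|/andP[_ t2] _].
  have [tp|tn|tz] := ltgtP 0 t; [exact: H| |by rewrite -tz eqxx in tn0].
  rewrite -oppr_eq0 -sinN -mulNr; apply: H; rewrite ?oppr_gt0 ?oppr_eq0//.
  by case/andP: tpi => ? ?; apply/andP; split; lra.
by rewrite gt_eqF// sin_gt0_pi//; have := @pi_gt0 R; move=> ?; apply/andP; split; lra.
Qed.

Lemma ln_cos_split t : t != p ->
  ln `|cos p - cos t| * arc_density t = window (K I1) (-1 * t + p) +
    (window (K I2) (1 * t + p) + (window (K I3) (1 * t + (p - 2 * pi))
       + - ln 2 * arc_density t)).
Proof.
move=> tp; have pi0 := @pi_gt0 R; case/andP: p0pi => p0 p1.
rewrite mulN1r mul1r addrA [- t + p]addrC [t + p]addrC.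
have -> : t + (p - 2 * pi) = p + t - 2 * pi by ring.
have F (b : bool) : ~ b -> b = false by move=> h; apply/negbTE/negP.
have [tin|tout] := boolP (0 <= t <= pi); last first.
  rewrite /arc_density (negbTE tout) !mulr0 addr0 /window /K /I1 /I2 /I3.
  have tout' : ~ (0 <= t <= pi) by apply/negP.
  rewrite (F (p - pi <= p - t <= p)); last first.
    by move=> /andP[? ?]; apply: tout'; apply/andP; split; lra.
  rewrite (F (p < p + t <= pi)); last first.
    by move=> /andP[? ?]; apply: tout'; apply/andP; split; lra.
  rewrite (F ((- pi < p + t - 2 * pi) && (p + t - 2 * pi < p - pi))); last first.
    by move=> /andP[? ?]; apply: tout'; apply/andP; split; lra.
  by rewrite !mulr0 !if_same !addr0.
rewrite /arc_density tin; case/andP: tin => t0 t1.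
have wlog0 : sin2_density t = 0 ->
    0 = window (K I1) (p - t) + (window (K I2) (p + t) + window (K I3) (p + t - 2 * pi)).
  move=> v0; rewrite /window /K.
  have e1 : p - (p - t) = t by ring.
  have e2 : p - (p + t) = - t by ring.
  have e3 : p - (p + t - 2 * pi) = 2 * pi - t by ring.
  rewrite e1 e2 e3 sin2_densityN sin2_density_period v0.
  by rewrite !if_same !mulr0 !if_same !addr0.
(* Where the weight vanishes, as at t = 0 and t = pi, both sides are 0 whichever pieces contain the
   point. From here on 0 < t < pi. *)
have [v0|v0] := eqVneq (sin2_density t) 0.
  by rewrite v0 !mulr0 addr0 -addrA -wlog0.
have tn0 : 0 < t.
  rewrite lt_neqAle t0 andbT; apply/eqP => tz; move: v0.
  by rewrite -tz sin2_density0 eqxx.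
have tnpi : t < pi.
  rewrite lt_neqAle t1 andbT; apply/eqP => tz; move: v0.
  by rewrite tz sin2_density_pi eqxx.
rewrite ln_cos_sub; last 2 first.
- apply: sin_half_neq0; last by rewrite subr_eq0 eq_sym.
  by apply/andP; split; lra.
- by rewrite gt_eqF// sin_gt0_pi//; apply/andP; split; lra.
have -> : window (K I1) (p - t) = lnsin (p - t) * sin2_density t.
  rewrite /window /K /I1 ifT; last by apply/andP; split; lra.
  rewrite ifT; last by apply/andP; split; lra.
  by have -> : p - (p - t) = t by ring.
suff -> : window (K I3) (p + t - 2 * pi) =
    lnsin (p + t) * sin2_density t - window (K I2) (p + t) by ring.
have e2 : p - (p + t) = - t by ring.
have e3 : p - (p + t - 2 * pi) = 2 * pi - t by ring.
rewrite /window /K /I2 /I3 e2 e3 sin2_densityN sin2_density_period lnsin_period.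
(* Exactly one of [I2] and [I3] receives p + t: the former before pi is passed, the latter after
   subtracting a period. *)
have [le|gt] := leP (p + t) pi.
  rewrite (F (- pi < p + t - 2 * pi <= pi)); last by move=> /andP[? ?]; lra.
  rewrite (_ : - pi < p + t) /=; last by lra.
  by rewrite (_ : p < p + t) /= ?subrr//; lra.
rewrite !andbF subr0 ifT; last by apply/andP; split; lra.
by rewrite ifT//; apply/andP; split; lra.
Qed.

(** The frequency 2 contributes cos (2 p) / 2 = cos^2 p - 1 / 2. The frequency 0 gives a constant
    that may stay unevaluated, as it goes into the Euler-Lagrange constant. *)
Lemma pot_semicircle_inside : pot semicircle (cos p) =
  (pi^-1 * wint (fun=> 1) - ln 2 - 1 / 2) + cos p ^+ 2.
Proof.
have n1 : (-1 : R) != 0 by rewrite oppr_eq0 oner_eq0.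
have i1 := integrable_affine p n1 (integrable_wint bm1).
have i2 := integrable_affine p (oner_neq0 R) (integrable_wint bm2).
have i3 := integrable_affine (p - 2 * pi) (oner_neq0 R) (integrable_wint bm3).
have ia : leb.-integrable setT (fun t => (arc_density t)%:E).
  apply/integrableP; split; first by apply/measurable_EFinP; exact: measurable_arc_density.
  under eq_integral do rewrite /= ger0_norm ?arc_density_ge0//.
  by rewrite integral_arc_density ltry.
have i4 := integrableZl measurableT (- ln 2) ia.
have i34 := integrableD measurableT i3 i4.
have i234 := integrableD measurableT i2 i34.
have i1234 := integrableD measurableT i1 i234.
have step : pot semicircle (cos p) = wint (K I1) + (wint (K I2) + (wint (K I3) + - ln 2)).
  apply: EFin_inj; rewrite pot_semicircle_cos !EFinD -!wintE//.
  rewrite (integral_affine p n1 (integrable_wint bm1)) normrN1 mul1e.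
  rewrite (integral_affine p (oner_neq0 R) (integrable_wint bm2)) normr1 mul1e.
  rewrite (integral_affine (p - 2 * pi) (oner_neq0 R) (integrable_wint bm3)) normr1 mul1e.
  have -> : (- ln 2)%:E = ((- ln 2)%:E * \int[leb]_t (arc_density t)%:E)%E.
    by rewrite integral_arc_density mule1.
  rewrite -(integralZl measurableT ia) -(integralD measurableT i3 i4).
  rewrite -(integralD measurableT i2 i34) -(integralD measurableT i1 i234).
  apply: (@eq_integral_except1 _ p).
  - apply/measurable_EFinP; apply: measurable_funM; last exact: measurable_arc_density.
    have mc := continuous_measurable_fun (@continuous_cos R).
    exact: (measurableT_comp (measurable_ln_norm_sub (cos p)) mc).
  - exact: measurable_int i1234.
  - by move=> t tp; rewrite /= -!EFinM -!EFinD ln_cos_split.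
have sumE : wint (K I1) + (wint (K I2) + (wint (K I3) + - ln 2)) =
    wint (fun t => sin2_density (p - t)) - ln 2.
  rewrite !addrA; congr (_ - _).
  rewrite -wintD// -wintD//; last exact: bounded_measurableD.
  apply: eq_wint => t /andP[t1 t2]; rewrite /K /I1 /I2 /I3 t1 t2 andbT /=.
  have [tp|tp] := leP t p.
    rewrite andbT addr0; case: (leP (p - pi) t) => _; by rewrite ?addr0 ?add0r.
  rewrite andbF add0r; case: ltP => [tq|_]; last by rewrite addr0.
  by exfalso; case/andP: p0pi => ? ?; have := @pi_gt0 R; lra.
rewrite step sumE.
have -> : (fun t => sin2_density (p - t)) = (fun t =>
    pi^-1 * 1 + (- (pi^-1 * cos (2 * p)) * cos (2 * t) + - (pi^-1 * sin (2 * p)) * sin (2 * t))).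
  by apply/funext => t; rewrite mulr1; exact: sin2_density_sub.
have b1 := bounded_measurable_cst (1 : R).
have bc := @bounded_measurable_cos2 R; have bs := @bounded_measurable_sin2 R.
rewrite wintD; [|exact: bounded_measurableZ|]; last first.
  by apply: bounded_measurableD; exact: bounded_measurableZ.
rewrite wintD; [|exact: bounded_measurableZ|exact: bounded_measurableZ].
rewrite !wintZ// wint_cos2 wint_sin2 cos_double.
have E (q w l c s : R) : q != 0 ->
    q^-1 * w + (- (q^-1 * (2 * c ^+ 2 - 1)) * - (q / 2) + - (q^-1 * s) * 0) - l =
    q^-1 * w - l - 1 / 2 + c ^+ 2 by move=> q0; field.
by apply: E; rewrite lt0r_neq0// pi_gt0.
Qed.

End inside.

(** Bounds the slope of the potential at the edge s. With y = cos t and s^2 = 1, sin^2 t = (1 - s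
    cos t) (1 + s cos t) cancels the denominator |s - cos t| = 1 - s cos t, leaving (2 / pi) (1 + s
    cos t), of integral 2. *)
Lemma integral_semicircle_inv (s : R) : s = 1 \/ s = -1 ->
  (\int[leb]_y ((expR (- ln `|s - y|))%:E * (semicircle y)%:E) <= 2%:E)%E.
Proof.
move=> s11.
have mg : measurable_fun setT (fun y : R => (expR (- ln `|s - y|))%:E).
  apply/measurable_EFinP; apply: measurableT_comp => //; apply: measurableT_comp => //.
  exact: measurable_ln_norm_sub.
rewrite integral_semicircle_cos//.
have pi0 := @pi_gt0 R.
have -> : 2 = ((2 / pi) * (pi + s * sin pi) - (2 / pi) * (0 + s * sin 0)) :> R.
  by rewrite sinpi sin0 !mulr0 !addr0 mulr0 subr0 divfK// gt_eqF.
rewrite -(@integral_is_derive R (fun t => (2 / pi) * (1 + s * cos t))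
  (fun t => (2 / pi) * (t + s * sin t)) 0 pi (pi_ge0 R)); last first.
  move=> t _; apply: cvgM; first exact: cvg_cst.
  apply: cvgD; first exact: cvg_cst.
  by apply: cvgM; [exact: cvg_cst|exact: continuous_cos].
rewrite [leRHS]integral_mkcond.
have mc : measurable_fun setT (@cos R).
  exact: continuous_measurable_fun (@continuous_cos R).
apply: ge0_le_integral => //.
- by move=> t _; rewrite -EFinM lee_fin mulr_ge0 ?expR_ge0// arc_density_ge0.
- apply: emeasurable_funM; last by apply/measurable_EFinP; exact: measurable_arc_density.
  exact: (measurableT_comp mg mc).
- apply/(measurable_restrictT _ (measurable_itv _))/measurable_funTS/measurable_EFinP.
  by apply: measurable_funM => //; apply: measurable_funD => //; exact: measurable_funM.
move=> t _; rewrite patchE mem_setE in_itv/= /arc_density.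
case: ifP => tin; last by rewrite mule0.
rewrite -EFinM lee_fin /sin2_density.
have c1 := cos_le1 t; have c2 := cos_geN1 t.
have sc : `|s * cos t| <= 1.
  by rewrite normrM; case: s11 => ->; rewrite ?normrN1 ?normr1 mul1r cos_max.
have p2 : 0 < 2 / pi :> R by rewrite divr_gt0.
have ns : `|s - cos t| = 1 - s * cos t.
  case: s11 => ->; first by rewrite mul1r ger0_norm// subr_ge0.
  by rewrite mulN1r opprK ler0_norm//; lra.
have ss : sin t ^+ 2 = (1 - s * cos t) * (1 + s * cos t).
  by rewrite sin2cos2; case: s11 => ->; ring.
rewrite mulrCA ler_pM2l// ss.
have r0 : 0 <= 1 + s * cos t by move: sc; rewrite ler_norml; lra.
have [z|nz] := eqVneq (1 - s * cos t) 0; first by rewrite z mul0r mulr0.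
have pz : 0 < `|s - cos t| by rewrite ns lt_neqAle eq_sym nz subr_ge0; move: sc; rewrite ler_norml; lra.
by rewrite expRN lnK ?posrE// ns mulrA mulVf// mul1r.
Qed.

(** For |y| <= 1, |s x - y| = A + (x - 1) with A = |s - y| = 1 - s y, and ln (A + d) <= ln A + d /
    A. Integrating leaves (x - 1) times the mean of 1 / A, which is at most 2. *)
Lemma pot_semicircle_outside (s x : R) : s = 1 \/ s = -1 -> 1 < x ->
  pot semicircle (s * x) <= pot semicircle s + 2 * (x - 1).
Proof.
move=> s11 x1; rewrite -lee_fin EFinD.
have i0 := integrable_ln_one_cut (s * x) lt11 hsc_gt0.
have i1 := integrable_ln_one_cut s lt11 hsc_gt0.
rewrite -(pot_one_cutE _ lt11 hsc_gt0) -(pot_one_cutE s lt11 hsc_gt0).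
have mg : measurable_fun setT (fun y : R => (expR (- ln `|s - y|) * semicircle y)%:E).
  apply/measurable_EFinP; apply: measurable_funM; last exact: measurable_semicircle.
  apply: measurableT_comp => //; apply: measurableT_comp => //.
  exact: measurable_ln_norm_sub.
have g0 y : 0 <= expR (- ln `|s - y|) * semicircle y.
  by rewrite mulr_ge0 ?expR_ge0// semicircle_ge0.
have ge2 : (\int[leb]_y (expR (- ln `|s - y|) * semicircle y)%:E <= 2%:E)%E.
  by under eq_integral do rewrite EFinM; exact: integral_semicircle_inv.
have ig : leb.-integrable setT (fun y : R => (expR (- ln `|s - y|) * semicircle y)%:E).
  apply/integrableP; split=> //.
  by under eq_integral do rewrite /= ger0_norm//; exact: le_lt_trans ge2 (ltry _).
have x10 : 0 <= x - 1 by lra.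
have iz := integrableZl measurableT (x - 1) ig.
apply: (@le_trans _ _ (\int[leb]_y ((ln `|s - y| * one_cut_density (-1) 1 hsc y)%:E +
    (x - 1)%:E * (expR (- ln `|s - y|) * semicircle y)%:E))%E); last first.
  rewrite (integralD measurableT i1 iz) leeD2l// (integralZl measurableT ig).
  rewrite EFinM muleC; apply: lee_wpmul2r => //.
apply: le_integral => //; first exact: integrableD.
move=> y _; rewrite -EFinM -EFinD lee_fin -[semicircle]/(one_cut_density (-1) 1 hsc).
rewrite mulrA -mulrDl; have [yin|yout] := boolP (-1 <= y <= 1); last first.
  by rewrite /one_cut_density (negbTE yout) !mulr0.
apply: ler_wpM2r; first exact: semicircle_ge0.
case/andP: yin => y1 y2.
have sy : `|s - y| = 1 - s * y.
  case: s11 => ->; first by rewrite mul1r ger0_norm// subr_ge0.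
  by rewrite mulN1r opprK ler0_norm//; lra.
have sxy : `|s * x - y| = (1 - s * y) + (x - 1).
  case: s11 => ->; first by rewrite !mul1r ger0_norm; lra.
  by rewrite !mulN1r opprK ler0_norm; lra.
rewrite sxy sy; have sy0 : 0 <= 1 - s * y by rewrite -sy.
(* At y = s the conventions ln 0 = 0 and exp (- ln 0) = 1 reduce the claim to ln (x - 1) <= x -
   1. *)
have [z|nz] := eqVneq (1 - s * y) 0.
  rewrite z add0r [ln 0]ln0// ?oppr0 ?expR0 ?mulr1 ?add0r.
  by apply/ltW/ln_sublinear; lra.
have pz : 0 < 1 - s * y by rewrite lt_neqAle eq_sym nz.
rewrite expRN lnK ?posrE//.
have -> : 1 - s * y + (x - 1) = (1 - s * y) * (1 + (x - 1) / (1 - s * y)).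
  by field.
have q0 : 0 <= (x - 1) / (1 - s * y) by rewrite divr_ge0.
rewrite lnM ?posrE//; last by lra.
by rewrite lerD2l; apply: le_ln1Dx; lra.
Qed.

Lemma semicircle_one_cut_data : one_cut_data (2 *: 'X^2 : {poly R}) (-1) 1 (2 / pi)%:P.
Proof.
split=> //; first exact: integral_semicircle.
set k : R := pi^-1 * wint (fun=> 1) - ln 2 - 1 / 2.
have inE x : -1 <= x <= 1 -> pot semicircle x = k + x ^+ 2.
  move=> x11; rewrite -(@acosK R x) ?in_itv//; apply: pot_semicircle_inside.
  by rewrite acos_ge0// acos_lepi.
have outE s x : s = 1 \/ s = -1 -> 1 < x ->
    2 * pot semicircle (s * x) - (2 *: 'X^2 : {poly R}).[s * x] < 2 * k.
  move=> s11 x1; have := pot_semicircle_outside s11 x1.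
  have s2 : s ^+ 2 = 1 by case: s11 => ->; rewrite ?sqrrN expr1n.
  rewrite (inE s); last by case: s11 => ->; apply/andP; split; lra.
  rewrite s2 hornerZ hornerXn exprMn s2 mul1r.
  (* The edge value k + 1 and the slope bound give 2 (k + 1 + 2 (x - 1)) - 2 x^2 = 2 k - 2 (x -
     1)^2. *)
  have : 0 < (x - 1) ^+ 2 by rewrite exprn_gt0//; lra.
  rewrite !expr2; lra.
exists (2 * k); split=> x xin.
  by rewrite -/semicircle inE// hornerZ hornerXn; ring.
rewrite -/semicircle.
have [x1|x1] := ltP 1 x; first by have := outE 1 x (or_introl erefl) x1; rewrite mul1r.
have x2 : 1 < - x.
  by rewrite ltNge; apply/negP => h; apply: xin; apply/andP; split; lra.
by have := outE (-1) (- x) (or_intror erefl) x2; rewrite mulN1r opprK.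
Qed.

End semicircle_data.

(** * Polynomials of even degree and the path *)

Section even_polynomials.
Context {R : realType}.
Implicit Types (p q V : {poly R}) (r u c s : R).

(** Being nonconstant replaces the normalization V(0) = 0 of [in_Pm], which affine substitutions do
    not preserve. *)
Definition pos_even (m : nat) p : Prop :=
  [/\ ~~ odd (size p).-1, (1 < size p <= m.+1)%N & 0 < lead_coef p].

Lemma pos_even_in_Pm m V : in_Pm m V -> pos_even m V.
Proof.
move=> [ev sz lc V0]; split=> //; rewrite sz andbT ltnNge; apply/negP => sz1.
by move: lc; rewrite (size1_polyC sz1) lead_coefC -horner_coef0 V0 ltxx.
Qed.

Lemma in_Pm_pos_even m V : pos_even m V -> V.[0] = 0 -> in_Pm m V.
Proof. by move=> [ev /andP[_ sz] lc]. Qed.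

Lemma size_affine r u : r != 0 -> size (affine r u) = 2%N.
Proof. by move=> r0; rewrite /affine size_polyDl size_scale ?size_polyX// size_polyC; case: eqP. Qed.

Lemma lead_coef_affine r u : r != 0 -> lead_coef (affine r u) = r.
Proof.
move=> r0; rewrite lead_coefDl ?lead_coefZ ?lead_coefX ?mulr1//.
by rewrite size_scale ?size_polyX// size_polyC; case: eqP.
Qed.

Lemma pos_even_affine m p r u : r != 0 -> pos_even m p -> pos_even m (p \Po affine r u).
Proof.
move=> r0 [ev sz lc]; have s2 := size_affine u r0.
split; rewrite ?size_comp_poly2// lead_coef_comp ?s2// lead_coef_affine//.
rewrite mulr_gt0// -(odd_double_half (size p).-1) (negbTE ev) add0n -mul2n exprM.
by rewrite exprn_gt0// exprn_even_gt0.
Qed.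

Lemma pos_evenBC m p c : pos_even m p -> pos_even m (p - c%:P).
Proof.
move=> [ev /andP[s1 s2] lc].
have lt : (size (- c%:P) < size p)%N.
  by rewrite size_polyN size_polyC; apply: leq_ltn_trans s1; case: eqP.
by split; rewrite ?size_polyDl ?lead_coefDl ?s1 ?s2.
Qed.

Lemma pos_evenZ m p c : 0 < c -> pos_even m p -> pos_even m (c *: p).
Proof.
move=> c0 [ev sz lc]; split; rewrite ?size_scale ?gt_eqF// lead_coefZ.
exact: mulr_gt0.
Qed.

(** Positive leading coefficients cannot cancel, so the degree of the sum is the larger of the two
    degrees. *)
Lemma pos_evenD m p q : pos_even m p -> pos_even m q -> pos_even m (p + q).
Proof.
wlog lt : p q / (size p <= size q)%N => [H pp pq|].
  have [|/ltnW] := leqP (size p) (size q); first by move=> /H; exact.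
  by rewrite addrC => /H; exact.
move=> [evp sp lp] [evq sq lq]; rewrite addrC.
have [e|ne] := eqVneq (size p) (size q); last first.
  have lt' : (size p < size q)%N by rewrite ltn_neqAle ne.
  by split; rewrite ?size_polyDl ?lead_coefDl.
have cq : (q + p)`_(size q).-1 = lead_coef q + lead_coef p.
  by rewrite coefD -lead_coefE -e -lead_coefE.
have c0 : 0 < (q + p)`_(size q).-1 by rewrite cq addr_gt0.
have se : size (q + p) = size q.
  apply/eqP; rewrite eqn_leq; apply/andP; split.
    by rewrite (leq_trans (size_polyD _ _))// e maxnn.
  have : ((size q).-1 < size (q + p)%R)%N.
    by rewrite ltnNge; apply/negP => /leq_sizeP/(_ _ (leqnn _)) z; rewrite z ltxx in c0.
  by case/andP: sq; case: (size q).
by split; rewrite ?se// lead_coefE se.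
Qed.

Lemma pos_even_convex m p q s : 0 <= s <= 1 -> pos_even m p -> pos_even m q ->
  pos_even m ((1 - s) *: p + s *: q).
Proof.
move=> /andP[s0 s1] pp pq.
have [->|sn0] := eqVneq s 0; first by rewrite subr0 scale1r scale0r addr0.
have [->|sn1] := eqVneq s 1; first by rewrite subrr scale1r scale0r add0r.
apply: pos_evenD; apply: pos_evenZ => //.
  by rewrite subr_gt0 lt_neqAle sn1.
by rewrite lt_neqAle eq_sym sn0.
Qed.

Lemma pos_even_2X2 m : (2 <= m)%N -> pos_even m (2 *: 'X^2).
Proof.
by move=> m2; split; rewrite ?size_scale ?size_polyXn// lead_coefZ lead_coefXn mulr1.
Qed.

(** An even positive degree is at least 2, so p - r X keeps the leading coefficient of p; made
    monic, it is positive beyond its Cauchy bound. *)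
Lemma pos_even_linear_lt m p r : pos_even m p ->
  exists b, forall x, b <= x -> r * x < p.[x].
Proof.
move=> [ev /andP[s1 _] lc].
have s2 : (2 < size p)%N.
  by move: ev s1; case: (size p) => [|[|[|]]].
have lt : (size (- (r *: 'X : {poly R})) < size p)%N.
  by rewrite size_polyN (leq_ltn_trans (size_scale_leq _ _))// size_polyX.
pose q := (lead_coef p)^-1 *: (p - r *: 'X).
have mq : q \is monic.
  by rewrite monicE lead_coefZ lead_coefDl// mulVf// gt_eqF.
have [b hb] := monic_Cauchy_bound mq; exists b => x /hb.
by rewrite hornerZ pmulr_rgt0 ?invr_gt0// !hornerE subr_gt0.
Qed.

(** Provides the lower bound assumed in the minimality argument. The left half-line is reduced to
    the right one by p(- x), and C = 4 b + M settles the interval |x| <= b, on which |p| <= M. *)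
Lemma pos_even_growth m p : pos_even m p ->
  exists2 C, 0 <= C & forall x, 4 * `|x| - C <= p.[x].
Proof.
move=> pp; have [b1 h1] := pos_even_linear_lt 4 pp.
have n1 : (-1 : R) != 0 by rewrite oppr_eq0 oner_eq0.
have [b2 h2] := pos_even_linear_lt 4 (pos_even_affine 0 n1 pp).
pose b := `|b1| + `|b2|; have [M hM] := poly_itv_bound p (- b) b.
have M0 : 0 <= M.
  apply: le_trans (normr_ge0 _) (hM 0 _).
  by rewrite oppr_le0 !addr_ge0.
have b10 := ler_norm b1; have b20 := ler_norm b2.
have b1p := normr_ge0 b1; have b2p := normr_ge0 b2.
have b0 : 0 <= b by rewrite addr_ge0.
exists (4 * b + M) => [|x]; first by rewrite addr_ge0// mulr_ge0.
have [xb|xb] := leP `|x| b.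
  have : `|p.[x]| <= M by apply: hM; rewrite -ler_norml.
  by rewrite ler_norml => /andP[? _]; lra.
have bE : b = `|b1| + `|b2| by [].
have [x0|x0] := leP 0 x.
  rewrite ger0_norm// in xb *.
  by have := h1 x; rewrite bE in xb *; lra.
rewrite ltr0_norm// in xb *.
have := h2 (- x); rewrite horner_comp horner_affine mulN1r opprK addr0.
by rewrite bE in xb *; lra.
Qed.

Lemma in_Pm1_of_one_cut_data m V a b h : pos_even m V ->
  one_cut_data V a b h -> V.[0] = 0 -> in_Pm1 m V.
Proof.
move=> pV dV V0; split; first exact: in_Pm_pos_even.
have [C C0 hC] := pos_even_growth pV.
exact: regular_of_one_cut_data C0 hC dV.
Qed.

End even_polynomials.

(** * Coefficient coordinates on the fields *)

Section coordinates.
Context {R : realType}.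
Implicit Types (W : {poly R}) (s : R).

(** Index i stands for the coefficient of X^(i + 1), so the coefficient 1 / 2 of the base field x^2
    / 2 is removed at i = 1. *)
Definition Vt_inv (m : nat) W : 'rV[R]_m :=
  \row_i (W`_i.+1 - (i == 1 :> nat)%:R / 2).

Lemma coef_Vt (m : nat) (t : 'rV[R]_m) (i : 'I_m) :
  (Vt t)`_i.+1 = t ord0 i + (i == 1 :> nat)%:R / 2.
Proof.
rewrite /Vt coefD coefCM coefXn coef_sum (bigD1 i)//= big1 => [|j ji].
  by rewrite coefZ coefXn eqxx mulr1 addr0 addrC eqSS mulrC.
by rewrite coefZ coefXn eqSS eq_sym (inj_eq val_inj) (negbTE ji) mulr0.
Qed.

Lemma size_Vt (m : nat) (t : 'rV[R]_m) : (2 <= m)%N -> (size (Vt t) <= m.+1)%N.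
Proof.
move=> m2; rewrite (leq_trans (size_polyD _ _))// geq_max; apply/andP; split.
  by rewrite mul_polyC (leq_trans (size_scale_leq _ _))// size_polyXn.
apply: (leq_trans (size_sum _ _ _)); apply/bigmax_leqP => i _.
by rewrite (leq_trans (size_scale_leq _ _))// size_polyXn ltnS ltn_ord.
Qed.

Lemma Vt_inv_Vt (m : nat) (t : 'rV[R]_m) : Vt_inv m (Vt t) = t.
Proof. by apply/rowP => i; rewrite mxE coef_Vt addrK. Qed.

Lemma Vt_Vt_inv (m : nat) W : (2 <= m)%N -> (size W <= m.+1)%N -> W.[0] = 0 ->
  Vt (Vt_inv m W) = W.
Proof.
move=> m2 sW W0; apply/polyP => -[|i].
  rewrite -horner_coef0 -[RHS]horner_coef0 W0 /Vt hornerD hornerM hornerXn.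
  rewrite expr0n mulr0 add0r horner_sum big1// => j _.
  by rewrite hornerZ hornerXn expr0n mulr0.
have [im|im] := ltnP i m; last first.
  have -> : (Vt (Vt_inv m W))`_i.+1 = 0.
    by apply/nth_default/(leq_trans (size_Vt _ m2)).
  by rewrite nth_default// (leq_trans sW).
by have := coef_Vt (Vt_inv m W) (Ordinal im); rewrite mxE subrK.
Qed.

(** The constant term is invisible to the coordinates, so the path can be defined from [W s] without
    normalizing its value at 0. *)
Lemma Vt_inv_subC (m : nat) W c : Vt_inv m (W - c%:P) = Vt_inv m W.
Proof. by apply/rowP => i; rewrite !mxE coefB coefC subr0. Qed.

Lemma continuous_row (m : nat) (f : R -> 'rV[R]_m) :
  (forall i, continuous (fun s => f s ord0 i)) -> continuous f.
Proof.
move=> cf s A [P nP sPA].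
have : \forall x \near s, forall i, P ord0 i (f x ord0 i).
  apply: (@filter_forall _ _ (fun i x => P ord0 i (f x ord0 i)) (nbhs s)) => i.
  exact: (cf i s _ (nP ord0 i)).
by apply: filterS => x hx; apply: sPA => i j; rewrite ord1.
Qed.

(** Induction along the Horner scheme: each coefficient is obtained from r s, u s and constants by
    sums and products. *)
Lemma continuous_coef_comp_affine (p : {poly R}) (r u : R -> R) k :
  continuous r -> continuous u -> continuous (fun s => (p \Po affine (r s) (u s))`_k).
Proof.
move=> cr cu; elim/poly_ind: p k => [|p c IH] k s.
  have -> : (fun s => (0 \Po affine (r s) (u s))`_k) = fun=> 0.
    by apply/funext => x; rewrite comp_poly0 coef0.
  exact: cvg_cst.
have -> : (fun s => ((p * 'X + c%:P) \Po affine (r s) (u s))`_k) = fun s =>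
    r s * (if k is k'.+1 then (p \Po affine (r s) (u s))`_k' else 0) +
    u s * (p \Po affine (r s) (u s))`_k + c%:P`_k.
  apply/funext => x; rewrite comp_polyD comp_polyM comp_polyX comp_polyC coefD.
  congr (_ + _); rewrite /affine mulrDr coefD coefMC -scalerAr coefZ coefMX mulrC.
  congr (_ + _); last by rewrite mulrC.
  by case: k => [|k] /=; rewrite mulrC.
apply: cvgD; last exact: cvg_cst.
apply: cvgD; apply: cvgM; [exact: cr| |exact: cu|exact: IH].
by case: k => [|k]; [exact: cvg_cst|exact: IH].
Qed.

End coordinates.

(** * The path from x^2 / 2 to the given field *)

Section path.
Context {R : realType}.
Variables (m : nat) (V : {poly R}) (a b : R) (h : {poly R}).
Hypotheses (m2 : (2 <= m)%N) (pV : pos_even m V) (V0 : V.[0] = 0)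
  (dV : one_cut_data V a b h).
Implicit Types s : R.

Let ab : a < b. Proof. by case: dV. Qed.
Let V11 := V \Po affine ((b - a) / 2) ((a + b) / 2).
(** [slope] and [shift] are the convex combinations of the coefficients of x / 2 and of (2 x - (a +
    b)) / (b - a). Both end slopes are positive, so the substitution is invertible for every s in
    [0, 1]; the end s = 0 gives 2 (x / 2)^2 = x^2 / 2. *)
Let slope s : R := (1 - s) / 2 + s * (2 / (b - a)).
Let shift s : R := s * (- (a + b) / (b - a)).
Let W s := ((1 - s) *: (2 *: 'X^2) + s *: V11) \Po affine (slope s) (shift s).

Let slope_gt0 s : 0 <= s <= 1 -> 0 < slope s.
Proof.
move=> /andP[s0 s1]; have d0 : 0 < 2 / (b - a) by rewrite divr_gt0// subr_gt0.
have [->|sn0] := eqVneq s 0; first by rewrite /slope mul0r addr0 subr0 divr_gt0.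
rewrite ltr_wpDl ?divr_ge0 ?subr_ge0// mulr_gt0//.
by rewrite lt_neqAle eq_sym sn0.
Qed.

Let W0 : W 0 = 2^-1 *: 'X^2.
Proof.
rewrite /W /slope /shift !mul0r subr0 scale1r scale0r !addr0 /affine addr0.
rewrite comp_polyZ comp_Xn_poly exprZn scalerA; congr (_ *: _).
by rewrite mul1r; field.
Qed.

Let W1 : W 1 = V.
Proof.
rewrite /W /slope /shift subrr mul0r add0r !mul1r scale0r add0r scale1r.
rewrite /V11 -comp_polyA (_ : affine _ _ \Po affine _ _ = 'X) ?comp_polyXr//; last first.
have d0 : b - a != 0 by rewrite subr_eq0 gt_eqF.
rewrite {1}/affine comp_polyD comp_polyZ comp_polyX comp_polyC /affine scalerDr scalerA.
rewrite -addrA (_ : (b - a) / 2 * (2 / (b - a)) = 1) ?scale1r; last by field.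
rewrite -mul_polyC -polyCM -polyCD (_ : (b - a) / 2 * (- (a + b) / (b - a)) + (a + b) / 2 = 0).
  by rewrite addr0.
by field.
Qed.

Let dW s : 0 <= s <= 1 -> exists a' b' h', one_cut_data (W s - (W s).[0]%:P) a' b' h'.
Proof.
move=> s01; have r0 : 0 < (b - a) / 2 by rewrite divr_gt0// subr_gt0.
have d1 := one_cut_data_affine ((a + b) / 2) 0 r0 dV.
have d0 : b - a != 0 by rewrite subr_eq0 gt_eqF.
have ea : (a - (a + b) / 2) / ((b - a) / 2) = -1 by field.
have eb : (b - (a + b) / 2) / ((b - a) / 2) = 1 by field.
rewrite subr0 ea eb in d1.
have d2 := one_cut_data_convex s01 semicircle_one_cut_data d1.
have d3 := one_cut_data_affine (shift s) (W s).[0] (slope_gt0 s01) d2.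
by do 3 eexists; exact: d3.
Qed.

Lemma one_cut_path : exists tau : R -> 'rV[R]_m,
  [/\ continuous tau, Vt (tau 0) = 2^-1 *: 'X^2, Vt (tau 1) = V &
      forall s, 0 <= s <= 1 -> in_Pm1 m (Vt (tau s))].
Proof.
have pU s : 0 <= s <= 1 -> pos_even m (W s - (W s).[0]%:P).
  move=> s01; apply/pos_evenBC/pos_even_affine; first by rewrite gt_eqF// slope_gt0.
  apply: pos_even_convex => //; first exact: pos_even_2X2.
  apply: pos_even_affine => //.
  by rewrite mulf_neq0 ?invr_eq0 ?pnatr_eq0// subr_eq0 gt_eqF.
have U0 s : (W s - (W s).[0]%:P).[0] = 0 by rewrite hornerD hornerN hornerC subrr.
have VtU s : 0 <= s <= 1 -> Vt (Vt_inv m (W s)) = W s - (W s).[0]%:P.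
  move=> s01; rewrite -(Vt_inv_subC _ _ (W s).[0]) Vt_Vt_inv//.
  by have [_ /andP[]] := pU s s01.
exists (fun s => Vt_inv m (W s)); split.
- apply: continuous_row => i s.
  have -> : (fun s => Vt_inv m (W s) ord0 i) = fun s =>
      (1 - s) * ((2 *: 'X^2) \Po affine (slope s) (shift s))`_i.+1 +
      s * (V11 \Po affine (slope s) (shift s))`_i.+1 - (i == 1 :> nat)%:R / 2.
    apply/funext => x; rewrite mxE /W comp_polyD !comp_polyZ coefD !coefZ.
    by [].
  have cs : continuous (fun s : R => 1 - s).
    by move=> x; apply: cvgB; [exact: cvg_cst|exact: cvg_id].
  have cslope : continuous slope.
    move=> x; apply: cvgD.
      by apply: cvgM; [exact: cs|exact: cvg_cst].
    by apply: cvgM; [exact: cvg_id|exact: cvg_cst].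
  have cshift : continuous shift.
    by move=> x; apply: cvgM; [exact: cvg_id|exact: cvg_cst].
  apply: cvgB; last exact: cvg_cst.
  apply: cvgD; apply: cvgM; [exact: cs| |exact: cvg_id|].
    exact: continuous_coef_comp_affine.
  exact: continuous_coef_comp_affine.
- by rewrite VtU ?lexx ?ler01// W0 hornerZ hornerXn expr0n mulr0 subr0.
- by rewrite VtU ?lexx ?ler01// W1 V0 subr0.
move=> s s01; rewrite VtU//; have [a' [b' [h' d]]] := dW s01.
exact: in_Pm1_of_one_cut_data (pU _ s01) d (U0 s).
Qed.

End path.

Theorem theorem2p3 (R : realType) (m : nat) (t : 'rV[R]_m) :
  (2 <= m)%N -> in_Pm1 m (Vt t) ->
  exists tau : R -> 'rV[R]_m,
    [/\ {within `[0, 1], continuous tau},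
        tau 0 = 0, tau 1 = t &
        forall s : R, s \in `[0, 1] -> in_Pm1 m (Vt (tau s))].
Proof.
move=> m2 [Pt rt]; have [a [b [h d]]] := one_cut_data_of_regular rt.
have V0 : (Vt t).[0] = 0 by case: Pt.
have [tau [ct t0 t1 tin]] := one_cut_path m2 (pos_even_in_Pm Pt) V0 d.
exists tau; split.
- exact: continuous_subspaceT.
(* A parameter is determined by its field, so the end points of the path are recovered from the end
   fields through [Vt_inv]. *)
- rewrite -(Vt_inv_Vt (tau 0)) t0; apply/rowP => i.
  by rewrite !mxE coefZ coefXn eqSS mulrC subrr.
- by rewrite -(Vt_inv_Vt (tau 1)) t1 Vt_inv_Vt.
- by move=> s; rewrite in_itv/=; exact: tin.
Qed.
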